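(* Let $\{\lambda^n/\mu^n\}_{n\ge0}$ be a graded skew partition sequence and for each $n\geq0$ put $u_n=e_{\lambda^n/\mu^n}$ and $m=|\lambda^n|-n$. Then the set $\{u_n\}_{n\geq0}$ is algebraically independent over $\mathbb Z$ and generates $\Lambda_{\mathbb{Z}}$ as a $\mathbb Z$-algebra if and only if, for each $n\geq 1$, $\lambda_1^n\geq n$ and $(\lambda^n,\mu^n)$ satisfies one of the following conditions: (1) $\mu^n=(m)$ and $\lambda_2^n<n$; (2) $\lambda^n=(n,m)$ with $m<n$, and $\mu^n$ is any partition of $m$; (3) $\lambda^n=(n+m)$, and $\mu^n$ is any partition of $m$.
   Context: $\Lambda_{\mathbb Z}$ is the ring of symmetric functions in infinitely many variables with integer coefficients, $e_\lambda=\prod_i e_{\lambda_i}$ the elementary symmetric functions, and the Hall inner product satisfies $\langle h_\lambda,m_\mu\rangle=\delta_{\lambda\mu}$. A skew partition of $n$ is any pair $(\lambda,\mu)$ of partitions with $|\lambda|-|\mu|=n$, written $\lambda/\mu$ (containment not assumed); a graded skew partition sequence has $\lambda^n/\mu^n$ a skew partition of $n$ for each $n$. The skew elementary function is defined by $\langle e_{\lambda/\mu},f\rangle=\langle e_\lambda,e_\mu f\rangle$ for all $f$. $\lambda^n_1\ge\lambda^n_2\ge\cdots$ are the parts of $\lambda^n$.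
   Formalization: Algebraic independence is stated for the u_n with n ≥ 1 only, since u_0 has degree 0 and is an integer, so a set containing it is never algebraically independent over Z; generation is still stated for all n ≥ 0. *)

(* Defs.v *)
From HB Require Import structures.
From mathcomp Require Import all_boot all_order all_algebra all_fingroup.
From mathcomp Require Import boolp classical_sets.
From mathcomp Require Import mpoly.

Set Implicit Arguments.
Unset Strict Implicit.
Unset Printing Implicit Defensive.

Import Order.TTheory GRing.Theory Num.Theory.

Local Open Scope ring_scope.

Definition is_part (s : seq nat) : bool := sorted geq s && (0%N \notin s).

Record intpart : predArgType :=
  IntPart { parts :> seq nat; partsP : is_part parts }.

HB.instance Definition _ := [isSub of intpart for parts].
HB.instance Definition _ := [Choice of intpart by <:].

(* Zeros in a displayed partition are insignificant: (m) means the            *)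
(* empty partition when m = 0, and (n, 0) means (n).                          *)
Definition nonzero_parts (s : seq nat) : seq nat := [seq k <- s | k != 0%N].

(* |la| - |mu| = n; the diagram of mu need not be contained in that of la.    *)
Definition is_skew_part (n : nat) (la mu : intpart) : Prop :=
  sumn la = (sumn mu + n)%N.

(* The ring of symmetric functions is the subring of the product of the rings *)
(* Z[x_0, .., x_(n-1)], n in nat, consisting of the families f such that each *)
(* f n is a symmetric polynomial, f n is obtained from f n.+1 by setting the  *)
(* last variable to 0, and the degrees of the f n are bounded.                *)

Definition mpseq : Type := forall n, {mpoly int[n]}.

HB.instance Definition _ := gen_eqMixin mpseq.
HB.instance Definition _ := gen_choiceMixin mpseq.

Section MpseqRing.

Implicit Types f g h : mpseq.

Definition mpseq_add f g : mpseq := fun n => f n + g n.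
Definition mpseq_opp f : mpseq := fun n => - f n.
Definition mpseq_mul f g : mpseq := fun n => f n * g n.

Fact mpseq_addA : associative mpseq_add.
Proof. by move=> f g h; apply: functional_extensionality_dep => n; apply: addrA. Qed.
Fact mpseq_addC : commutative mpseq_add.
Proof. by move=> f g; apply: functional_extensionality_dep => n; apply: addrC. Qed.
Fact mpseq_add0 : left_id (fun n => 0) mpseq_add.
Proof. by move=> f; apply: functional_extensionality_dep => n; apply: add0r. Qed.
Fact mpseq_addN : left_inverse (fun n => 0) mpseq_opp mpseq_add.
Proof. by move=> f; apply: functional_extensionality_dep => n; apply: addNr. Qed.

HB.instance Definition _ := GRing.isZmodule.Build mpseq
  mpseq_addA mpseq_addC mpseq_add0 mpseq_addN.

Fact mpseq_mulA : associative mpseq_mul.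
Proof. by move=> f g h; apply: functional_extensionality_dep => n; apply: mulrA. Qed.
Fact mpseq_mulC : commutative mpseq_mul.
Proof. by move=> f g; apply: functional_extensionality_dep => n; apply: mulrC. Qed.
Fact mpseq_mul1 : left_id (fun n => 1) mpseq_mul.
Proof. by move=> f; apply: functional_extensionality_dep => n; apply: mul1r. Qed.
Fact mpseq_mulD : left_distributive mpseq_mul mpseq_add.
Proof. by move=> f g h; apply: functional_extensionality_dep => n; apply: mulrDl. Qed.
Fact mpseq_1n0 : (fun n => 1) != 0 :> mpseq.
Proof. by apply/eqP => /(congr1 (fun f : mpseq => f 0%N))/eqP; rewrite oner_eq0. Qed.

HB.instance Definition _ := GRing.Zmodule_isComNzRing.Build mpseq
  mpseq_mulA mpseq_mulC mpseq_mul1 mpseq_mulD mpseq_1n0.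

End MpseqRing.

Definition mrestr n (p : {mpoly int[n.+1]}) : {mpoly int[n]} :=
  p \mPo [tuple if unlift ord_max i is Some j then 'X_j else 0 | i < n.+1].

Definition symfun_pred (f : mpseq) : Prop :=
  [/\ forall n, f n \is symmetric,
      forall n, mrestr (f n.+1) = f n
    & exists d, forall n, (msize (f n) <= d)%N].

Definition is_symfun : pred mpseq := fun f => `[< symfun_pred f >].

Fact is_symfun_subring : subring_closed is_symfun.
Proof.
split.
- apply/asboolP; split=> [n|n|]; first exact: rpred1.
    by rewrite /mrestr rmorph1.
  by exists 1%N => n; rewrite msize1.
- move=> f g /asboolP[sf cf [df bf]] /asboolP[sg cg [dg bg]].
  apply/asboolP; split=> [n|n|]; first exact: rpredB (sf n) (sg n).
    by rewrite -[RHS]/(f n - g n) -(cf n) -(cg n); apply: raddfB.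
  exists (maxn df dg) => n; rewrite -[(f - g) n]/(f n - g n); apply: leq_trans (msizeD_le _ _) _.
  rewrite msizeN geq_max !leq_max bf orTb /=.
  by rewrite bg orbT.
- move=> f g /asboolP[sf cf [df bf]] /asboolP[sg cg [dg bg]].
  apply/asboolP; split=> [n|n|]; first exact: rpredM (sf n) (sg n).
    by rewrite -[RHS]/(f n * g n) -(cf n) -(cg n); apply: rmorphM.
  exists (df + dg)%N => n; rewrite -[(f * g) n]/(f n * g n).
  have [->|fn0] := eqVneq (f n) 0; first by rewrite mul0r msize0.
  have [->|gn0] := eqVneq (g n) 0; first by rewrite mulr0 msize0.
  by rewrite msizeM //; apply: leq_trans (leq_pred _) (leq_add (bf n) (bg n)).
Qed.

HB.instance Definition _ :=
  GRing.isSubringClosed.Build mpseq is_symfun is_symfun_subring.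

Record symfun : predArgType :=
  SymFun { symfun_val :> mpseq; symfunP : is_symfun symfun_val }.

HB.instance Definition _ := [isSub of symfun for symfun_val].
HB.instance Definition _ := [Choice of symfun by <:].
HB.instance Definition _ := [SubChoice_isSubComNzRing of symfun by <:].

Definition mshape n (m : 'X_{1..n}) : seq nat := sort geq (nonzero_parts m).

Fact mcoeff_mrestr n (p : {mpoly int[n.+1]}) (m : 'X_{1..n}) :
  (mrestr p)@_m = p@_(mnmwiden m).
Proof.
rewrite /mrestr comp_mpolyEX raddf_sum /= [in RHS](mpolyE p) raddf_sum /=.
apply: eq_bigr => k _; rewrite !mcoeffZ; congr (_ * _).
rewrite comp_mpolyX mcoeffX big_ord_recr /= tnth_mktuple unlift_none.
have [k0|k0] := posnP (k ord_max).
  rewrite k0 expr0 mulr1.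
  have -> : \prod_(i < n) tnth [tuple if unlift ord_max i is Some j then 'X_j
      else 0 | i < n.+1] (widen_ord (leqnSn n) i) ^+ k (widen_ord (leqnSn n) i)
      = 'X_[int, [multinom k (widen_ord (leqnSn n) i) | i < n]].
    rewrite [RHS]mpolyXE_id; apply: eq_bigr => i _; rewrite mnmE tnth_mktuple.
    have -> : widen_ord (leqnSn n) i = lift ord_max i.
      by apply/val_inj; rewrite /= /bump leqNgt ltn_ord.
    by rewrite liftK.
  rewrite mcoeffX; congr (_%:R); congr nat_of_bool; apply/eqP/eqP=> [<-|->].
    apply/mnmP => i; have [j ->|->] := unliftP ord_max i; last first.
      by rewrite mnmwiden_ordmax k0.
    have -> : lift ord_max j = widen_ord (leqnSn n) j.
      by apply/val_inj; rewrite /= /bump leqNgt ltn_ord.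
    by rewrite mnmwiden_widen mnmE.
  by apply/mnmP => i; rewrite mnmE mnmwiden_widen.
rewrite expr0n eqn0Ngt k0 mulr0 mcoeff0.
by case: eqP => // kE; rewrite kE mnmwiden_ordmax in k0.
Qed.

Fact mshape_mnmwiden n (m : 'X_{1..n}) : mshape (mnmwiden m) = mshape m.
Proof. by rewrite /mshape /nonzero_parts /= filter_rcons. Qed.

Fact mshape_perm n (m : 'X_{1..n}) (s : 'S_n) : mshape [multinom m (s i) | i < n] = mshape m.
Proof.
rewrite /mshape; apply/perm_sortP.
- by move=> a b; apply: leq_total.
- by move=> a b c /= ba ac; apply: leq_trans ac ba.
- by move=> a b /= ab; apply/anti_leq; rewrite andbC.
apply: perm_filter; apply/tuple_permP; exists s.
by [].
Qed.

Fact mdeg_mshape n (m : 'X_{1..n}) : mdeg m = sumn (mshape m).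
Proof.
rewrite /mdeg /mshape [RHS](perm_sumn (permEl (perm_sort _ _))) /nonzero_parts.
rewrite -sumnE; elim: (tval m) => //= a l ->; by case: a.
Qed.

Fact shape_symfun (F : mpseq) (Q : pred (seq nat)) (d : nat) :
  (forall n (m : 'X_{1..n}), (F n)@_m = (Q (mshape m))%:R) ->
  (forall s, Q s -> (sumn s <= d)%N) -> is_symfun F.
Proof.
move=> FE Fd; apply/asboolP; split.
- move=> n; apply/issymP => s; apply/mpolyP => m.
  by rewrite mcoeff_sym !FE mshape_perm.
- by move=> n; apply/mpolyP => m; rewrite mcoeff_mrestr !FE mshape_mnmwiden.
- exists d.+1 => n; rewrite msizeE; apply/bigmax_leqP_seq => m + _.
  rewrite mcoeff_msupp FE mdeg_mshape ltnS.
  by case QE: (Q _) => //; rewrite ?eqxx // => _; apply: Fd.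
Qed.

Definition elem_seq (k : nat) : mpseq := fun n => mesym n int k.

Definition complete_seq (k : nat) : mpseq :=
  fun n => \sum_(m : 'X_{1..n < k.+1} | mdeg m == k) 'X_[m].

Definition monom_seq (la : intpart) : mpseq :=
  fun n => \sum_(m : 'X_{1..n < (sumn la).+1} | mshape m == la) 'X_[m].

Fact mcoeff_sumX n (d : nat) (P : pred 'X_{1..n}) (k : 'X_{1..n}) :
  (P k -> mdeg k < d)%N ->
  (\sum_(m : 'X_{1..n < d} | P m) 'X_[m] : {mpoly int[n]})@_k = (P k)%:R.
Proof.
move=> Pd; rewrite raddf_sum /=; case: (boolP (P k)) => [Pk|nPk].
  rewrite (bigD1 (BMultinom (Pd Pk))) //= mcoeffX eqxx big1 ?addr0 // => m.
  by case/andP=> _ /negbTE mk; rewrite mcoeffX -[_ == k]/(val m == val (BMultinom (Pd Pk))) val_eqE mk.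
rewrite big1 // => m Pm; rewrite mcoeffX.
by case: eqP => // mk; rewrite -mk Pm in nPk.
Qed.

Fact elem_symfun k : is_symfun (elem_seq k).
Proof.
apply: (@shape_symfun _ (fun s => (sumn s == k) && all (geq 1) s) k).
  move=> n m; rewrite mcoeff_mesym /mechar mdeg_mshape; congr (_ && _)%:R.
  rewrite /mshape all_sort all_filter.
  apply/forallP/allP => /= [m1 _ /tnthP[i ->]|m1 i].
    by apply/implyP => _; rewrite -mnm_tnth; apply: m1.
  have := m1 (m i); rewrite mnm_tnth mem_tnth => /(_ isT) /implyP.
  by case: (tnth m i) => //= a; apply.
by move=> s /andP[/eqP-> _].
Qed.

Fact complete_symfun k : is_symfun (complete_seq k).
Proof.
apply: (@shape_symfun _ (fun s => sumn s == k) k) => [n m|s /eqP-> //].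
by rewrite -mdeg_mshape (@mcoeff_sumX n k.+1 (fun m => mdeg m == k)) // => /eqP ->.
Qed.

Fact monom_symfun la : is_symfun (monom_seq la).
Proof.
apply: (@shape_symfun _ (fun s => s == la) (sumn la)) => [n m|s /eqP-> //].
by rewrite (@mcoeff_sumX n _ (fun m => mshape m == la)) // mdeg_mshape => /eqP ->.
Qed.

Definition elementary (k : nat) : symfun := SymFun (elem_symfun k).
Definition complete_hom (k : nat) : symfun := SymFun (complete_symfun k).

Definition sym_e (la : intpart) : symfun := \prod_(k <- la) elementary k.
Definition sym_h (la : intpart) : symfun := \prod_(k <- la) complete_hom k.
Definition sym_m (la : intpart) : symfun := SymFun (monom_symfun la).

(* Z-bilinearity is biadditivity.                                             *)
Definition is_hall_product (B : symfun -> symfun -> int) : Prop :=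
  [/\ forall f1 f2 g, B (f1 + f2) g = B f1 g + B f2 g,
      forall f g1 g2, B f (g1 + g2) = B f g1 + B f g2
    & forall la mu, B (sym_h la) (sym_m mu) = (la == mu)%:R].

(* The h_la and the m_mu being two Z-bases of the ring, exactly one B         *)
(* satisfies is_hall_product; the default value of xget is never reached.     *)
Definition hall : symfun -> symfun -> int :=
  xget (fun _ _ => 0) [set B | is_hall_product B].

(* Likewise, since hall is perfect, exactly one u has the stated property.    *)
Definition skew_e (la mu : intpart) : symfun :=
  xget 0 [set u | forall f, hall u f = hall (sym_e la) (sym_e mu * f)].

Definition zeval (A : comNzRingType) (x : nat -> A) (N : nat)
  (P : {mpoly int[N]}) : A := mmap intr (fun i : 'I_N => x i) P.

(* Every polynomial relation involves finitely many terms, hence terms of     *)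
(* index below some N.                                                        *)
Definition alg_independent (A : comNzRingType) (x : nat -> A) : Prop :=
  forall N (P : {mpoly int[N]}), zeval x P = 0 -> P = 0.

Definition alg_generates (A : comNzRingType) (x : nat -> A) : Prop :=
  forall a : A, exists N (P : {mpoly int[N]}), zeval x P = a.

(* Main.v *)
(** Let p_n = m_(n).  Since <h_la, p_n> vanishes unless la = (n), the map
    f |-> <f, p_n> is a derivation over the constant term, so it kills
    decomposables.  Therefore homogeneous u_n (n >= 1) generate the ring iff
    <u_n, p_n> = 1 or -1 for all n: each u_k with k <> n pairs to 0, hence
    <u_n, p_n> divides <h_n, p_n> = 1; conversely the relations
    u_n = +- h_n + (polynomial in h_1, ..., h_(n-1)) are solved recursively.
    The products u_la with |la| <= d then span the elements of degree <= d,
    as many as the m_la, so they are linearly independent.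

    For u_n = e_(la/mu), applying omega turns <e_la, e_mu p_n> into
    +- <h_la, h_mu p_n>, the coefficient of x^la in h_mu p_n.  That is the sum,
    over the i with la_i >= n, of the number of matrices of nonnegative
    integers with margins la - n eps_i and mu.  Each such number is positive,
    and it is 1 iff one of the two margins has at most one nonzero entry. *)

From HB Require Import structures.
Require Import Defs.
From mathcomp Require Import all_boot all_order all_algebra all_fingroup.
From mathcomp Require Import boolp classical_sets.
From mathcomp Require Import mpoly zify.

Set Implicit Arguments.
Unset Strict Implicit.
Unset Printing Implicit Defensive.

Import Order.TTheory GRing.Theory Num.Theory.

Local Open Scope ring_scope.

(** * Coefficients, shapes and degrees of symmetric functions *)

Definition sfn n (f : symfun) : {mpoly int[n]} := symfun_val f n.

Fact sfn_zmod n : zmod_morphism (@sfn n).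
Proof. by []. Qed.

Fact sfn_monoid n : monoid_morphism (@sfn n).
Proof. by []. Qed.

HB.instance Definition _ n :=
  GRing.isZmodMorphism.Build symfun {mpoly int[n]} (@sfn n) (@sfn_zmod n).
HB.instance Definition _ n :=
  GRing.isMonoidMorphism.Build symfun {mpoly int[n]} (@sfn n) (@sfn_monoid n).

Arguments sfn : simpl never.

Lemma sfn_inj (f g : symfun) : (forall n, sfn n f = sfn n g) -> f = g.
Proof.
by move=> fg; apply/val_inj/functional_extensionality_dep => n; apply: fg.
Qed.

Definition smon n (s : seq nat) : 'X_{1..n} := [multinom nth 0%N s i | i < n].

Lemma mkpartP (s : seq nat) : is_part (sort geq (nonzero_parts s)).
Proof.
apply/andP; split; first by apply: sort_sorted => a b; apply: leq_total.
by rewrite mem_sort mem_filter eqxx.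
Qed.

Definition mkpart (s : seq nat) : intpart := IntPart (mkpartP s).

Definition mpart n (m : 'X_{1..n}) : intpart := mkpart m.

Lemma size_mshape n (m : 'X_{1..n}) : (size (mshape m) <= n)%N.
Proof.
by rewrite size_sort size_filter (leq_trans (count_size _ _)) ?size_tuple.
Qed.

Lemma geq_sorted_eq (s t : seq nat) :
  sorted geq s -> sorted geq t -> perm_eq s t -> s = t.
Proof.
apply: sorted_eq => [a b c /= ba ac|a b /= ab]; first exact: leq_trans ac ba.
by apply/anti_leq; rewrite andbC.
Qed.

Lemma nonzero_parts_id s : 0%N \notin s -> nonzero_parts s = s.
Proof.
move=> s0; apply/all_filterP/allP => k ks.
by apply: contraNneq s0 => <-.
Qed.

Lemma val_smon n s : smon n s = mkseq (nth 0%N s) n :> seq nat.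
Proof. by rewrite /smon /= /mkseq -val_enum_ord -map_comp. Qed.

Lemma nonzero_smon n s : (size s <= n)%N ->
  nonzero_parts (smon n s) = nonzero_parts s.
Proof.
move=> sn; rewrite val_smon -(subnKC sn) /mkseq iotaD map_cat /nonzero_parts filter_cat.
rewrite add0n map_nth_iota0 // take_size -[RHS]cats0; congr (_ ++ _).
apply/eqP; rewrite -size_eq0 size_filter -leqn0 leqNgt -has_count.
apply/negP => /hasP[k /mapP[i + ->]]; rewrite mem_iota => /andP[si _].
by rewrite nth_default ?eqxx.
Qed.

Lemma mpart_smon n (la : intpart) : (size la <= n)%N -> mpart (smon n la) = la.
Proof.
move=> sn; apply/val_inj; rewrite /= /mshape nonzero_smon //.
case: la {sn} => s /= /andP[ss s0]; rewrite nonzero_parts_id //.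
apply/geq_sorted_eq => //; last by rewrite (permEl (perm_sort _ _)).
by apply: sort_sorted => a b; apply: leq_total.
Qed.

Lemma mdeg_smon n (la : intpart) : (size la <= n)%N -> mdeg (smon n la) = sumn la.
Proof. by move=> sn; rewrite mdeg_mshape -[mshape _]/(parts (mpart _)) mpart_smon. Qed.

(** Each exponent vector is a permutation of its shape padded with zeros to length [n]. *)
Lemma mshape_eq_perm n (m k : 'X_{1..n}) : mshape m = mshape k -> perm_eq m k.
Proof.
have P (u : 'X_{1..n}) : perm_eq u (mshape u ++ nseq (n - size (mshape u)) 0%N).
  have -> : nseq (n - size (mshape u)) 0%N = filter (predC (fun k => k != 0%N)) u.
    have /all_pred1P : all (pred1 0%N) (filter (predC (fun k => k != 0%N)) u).
      by apply/allP => i; rewrite mem_filter /= negbK => /andP[].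
    move=> ->; congr nseq; rewrite size_sort !size_filter -[n in (n - _)%N](size_tuple u).
    by rewrite -(count_predC (fun k => k != 0%N)) addKn.
  rewrite perm_sym -(permPr (permEl (perm_filterC (fun k => k != 0%N) u))) perm_cat2r.
  exact: permEl (perm_sort _ _).
by move=> mk; rewrite (permPl (P m)) mk perm_sym.
Qed.

Lemma sfn_sym n (f : symfun) : sfn n f \is symmetric.
Proof. by have /asboolP[] := symfunP f. Qed.

Lemma mcoeff_sfnS n (f : symfun) (m : 'X_{1..n}) :
  (sfn n.+1 f)@_(mnmwiden m) = (sfn n f)@_m.
Proof. by have /asboolP[_ cf _] := symfunP f; rewrite -mcoeff_mrestr cf. Qed.

Lemma mcoeff_eq_mshape n (f : symfun) (m k : 'X_{1..n}) : mshape m = mshape k ->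
  (sfn n f)@_m = (sfn n f)@_k.
Proof.
move=> /mshape_eq_perm; rewrite perm_sym => /tuple_permP[s ks].
have /issymP/(_ s) := sfn_sym n f => /(congr1 (mcoeff m)).
rewrite mcoeff_sym => <-; congr mcoeff; apply/val_inj => /=; apply/val_inj => /=.
by rewrite ks; apply: eq_map => i; rewrite mnm_tnth.
Qed.

(** The coefficient of x^s, read in exactly [size s] variables; by stability any larger number of
    variables gives the same value. *)
Definition scoef (s : seq nat) (f : symfun) : int := (sfn (size s) f)@_(smon _ s).

Lemma mnmwiden_smon n s : (size s <= n)%N -> mnmwiden (smon n s) = smon n.+1 s.
Proof.
move=> sn; apply/mnmP => i; have [j ->|->] := unliftP ord_max i; last first.
  by rewrite mnmwiden_ordmax mnmE nth_default.
have -> : lift ord_max j = widen_ord (leqnSn n) j.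
  by apply/val_inj; rewrite /= /bump leqNgt ltn_ord.
by rewrite mnmwiden_widen !mnmE.
Qed.

Lemma mcoeff_smon n f s : (size s <= n)%N -> (sfn n f)@_(smon n s) = scoef s f.
Proof.
move=> /subnKC <-; elim: (n - size s)%N => [|k IHk]; first by rewrite addn0.
by rewrite addnS -mnmwiden_smon ?leq_addr // mcoeff_sfnS.
Qed.

(** Symmetry allows the exponents to be sorted and stability allows the zeros to be dropped, so the
    coefficients at partitions determine the function. *)
Lemma mcoeff_scoef n f (m : 'X_{1..n}) : (sfn n f)@_m = scoef (mpart m) f.
Proof.
rewrite -(mcoeff_smon (n := n)) ?size_mshape //; apply: mcoeff_eq_mshape.
have sz : (size (mpart m) <= n)%N := size_mshape m.
by rewrite -[LHS]/(parts (mpart m)) -[in LHS](mpart_smon sz).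
Qed.

Lemma scoef_ext f g : (forall la : intpart, scoef la f = scoef la g) -> f = g.
Proof.
by move=> fg; apply/sfn_inj => n; apply/mpolyP => m; rewrite !mcoeff_scoef.
Qed.

Fact scoef_zmod s : zmod_morphism (scoef s).
Proof. by move=> f g; rewrite /scoef rmorphB mcoeffB. Qed.
HB.instance Definition _ s :=
  GRing.isZmodMorphism.Build symfun int (scoef s) (scoef_zmod s).

Definition deg_le d (f : symfun) :=
  forall la : intpart, (d < sumn la)%N -> scoef la f = 0.

Lemma deg_le_msize d f : deg_le d f <-> (forall n, msize (sfn n f) <= d.+1)%N.
Proof.
split=> [fd n|fd la lad]; last first.
  apply/eqP; rewrite mcoeff_eq0; apply/negP => /msize_mdeg_lt lt.
  by have := leq_trans lt (fd _); rewrite mdeg_smon // ltnS leqNgt lad.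
rewrite msizeE; apply/bigmax_leqP_seq => m + _.
rewrite mcoeff_msupp mcoeff_scoef mdeg_mshape ltnS; apply: contraNT; rewrite -ltnNge => lt.
by rewrite fd.
Qed.

Lemma deg_le_ex f : exists d, deg_le d f.
Proof.
have /asboolP[_ _ [d fd]] := symfunP f; exists d; apply/deg_le_msize => n.
exact: leqW (fd n).
Qed.

Lemma size_le_sumn (la : intpart) : (size la <= sumn la)%N.
Proof.
case: la => s /= /andP[_]; elim: s => //= a s IHs.
by rewrite inE negb_or => /andP[a0 /IHs]; move: a0; case: a => //= a; lia.
Qed.

(** A partition of size at most [d] has at most [d] parts, so [d] variables show every coefficient
    that can be nonzero. *)
Lemma symfun_eq_deg d f g : deg_le d f -> deg_le d g -> sfn d f = sfn d g -> f = g.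
Proof.
move=> fd gd fg; apply: scoef_ext => la; case: (ltnP d (sumn la)) => [lt|le].
  by rewrite fd ?gd.
by rewrite -!(mcoeff_smon (n := d)) ?fg //; apply: leq_trans (size_le_sumn _) le.
Qed.

Lemma scoef_m (la mu : intpart) : scoef la (sym_m mu) = (la == mu)%:R.
Proof.
rewrite /scoef /sfn /= /monom_seq.
rewrite (@mcoeff_sumX _ _ (fun m => mshape m == mu)); last by rewrite mdeg_mshape => /eqP ->.
by rewrite -[mshape _]/(parts (mpart _)) mpart_smon.
Qed.

Lemma perm_mkpart s : perm_eq (mkpart s) (nonzero_parts s).
Proof. exact: permEl (perm_sort _ _). Qed.

Lemma sumn_nonzero_parts s : sumn (nonzero_parts s) = sumn s.
Proof. by elim: s => //= a s <-; case: a. Qed.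

Lemma sumn_mkpart s : sumn (mkpart s) = sumn s.
Proof. by rewrite (perm_sumn (perm_mkpart s)) sumn_nonzero_parts. Qed.

Lemma part_neq0 (la : intpart) : 0%N \notin parts la.
Proof. by case: la => s /= /andP[]. Qed.

Lemma perm_mkpart_pos s : 0%N \notin s -> perm_eq (mkpart s) s.
Proof. by move=> s0; rewrite (permPl (perm_mkpart s)) nonzero_parts_id. Qed.

Lemma mkpart1 n : (0 < n)%N -> mkpart [:: n] = [:: n] :> seq nat.
Proof.
move=> n0; have s0: 0%N \notin [:: n] by rewrite inE; case: n n0.
by apply: perm_small_eq => //; apply: perm_mkpart_pos.
Qed.

Lemma part_perm_eq (la mu : intpart) : perm_eq la mu -> la = mu.
Proof.
move=> pe; apply/val_inj/geq_sorted_eq => //.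
  by case: la {pe} => s /= /andP[].
by case: mu {pe} => s /= /andP[].
Qed.

Lemma mkpart_id (la : intpart) : mkpart la = la.
Proof. by apply/part_perm_eq/perm_mkpart_pos/part_neq0. Qed.

(** A partition of size at most [d] has at most [d] parts, each at most [d]; padded with zeros, it
    occurs among the [d]-tuples over ['I_d.+1]. *)
Definition pseq d : seq intpart :=
  [seq la : intpart <- undup [seq mkpart [seq val i | i <- t] | t : d.-tuple 'I_d.+1]
    | (sumn la <= d)%N].

Lemma pseq_uniq d : uniq (pseq d).
Proof. exact/filter_uniq/undup_uniq. Qed.

Lemma leq_sumn_mem (s : seq nat) k : k \in s -> (k <= sumn s)%N.
Proof.
elim: s => //= a s IHs; rewrite inE => /predU1P[->|/IHs]; first exact: leq_addr.
by move/leq_trans; apply; apply: leq_addl.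
Qed.

Lemma leq_nth_sumn (s : seq nat) i : (nth 0%N s i <= sumn s)%N.
Proof.
have [lt|le] := ltnP i (size s); last by rewrite nth_default.
by rewrite leq_sumn_mem // mem_nth.
Qed.

Lemma mem_pseq d (la : intpart) : (la \in pseq d) = (sumn la <= d)%N.
Proof.
rewrite mem_filter andb_idr // => la_d; rewrite mem_undup; apply/mapP.
exists [tuple inord (nth 0%N la i) | i < d]; first by rewrite mem_enum.
apply/part_perm_eq; rewrite perm_sym (permPl (perm_mkpart _)).
have -> : [seq val i | i <- [tuple inord (nth 0%N la i) : 'I_d.+1 | i < d]] = smon d la.
  rewrite val_smon /= /mkseq -val_enum_ord -!map_comp; apply: eq_map => i /=.
  by rewrite inordK // ltnS (leq_trans (leq_nth_sumn _ _)).
rewrite nonzero_smon ?nonzero_parts_id ?part_neq0 //.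
exact: leq_trans (size_le_sumn _) la_d.
Qed.

(** * Integral spans of products of a family, filtered by weight *)

Section Span.

(** [sym_h] and [sym_e] are convertible to the cases [complete_hom] and [elementary]. *)
Definition gp (g : nat -> symfun) (s : seq nat) : symfun := \prod_(k <- s) g k.

Lemma gp_mkpart g s : 0%N \notin s -> gp g (mkpart s) = gp g s.
Proof. by move=> s0; apply: perm_big; apply: perm_mkpart_pos. Qed.

(** Parts are positive, so [g 0] never occurs; [d] bounds the sum of the indices in each product,
    whatever the degrees of the [g k]. *)
Inductive Sp (g : nat -> symfun) d : symfun -> Prop :=
| Sp0 : Sp g d 0
| SpS f (la : intpart) z : Sp g d f -> (sumn la <= d)%N ->
    Sp g d (f + gp g la *~ z).

Implicit Types g : nat -> symfun.

Lemma Sp_add g d f f' : Sp g d f -> Sp g d f' -> Sp g d (f + f').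
Proof.
move=> Sf; elim=> [|{}f' la z _ IH lad]; first by rewrite addr0.
by rewrite addrA; apply: SpS.
Qed.

Lemma Sp_gp g d (la : intpart) : (sumn la <= d)%N -> Sp g d (gp g la).
Proof.
move=> lad; rewrite -[gp g la]mulr1z -[_ *~ _]add0r.
by apply: SpS => //; apply: Sp0.
Qed.

Lemma Sp_mulz g d f z : Sp g d f -> Sp g d (f *~ z).
Proof.
elim=> [|{}f la y _ IH lad]; first by rewrite mul0rz; apply: Sp0.
by rewrite mulrzDl -mulrzA; apply: SpS.
Qed.

Lemma Sp_opp g d f : Sp g d f -> Sp g d (- f).
Proof. by rewrite -[- f](mulrN1z f); apply: Sp_mulz. Qed.

Lemma Sp_sum g d (I : Type) (r : seq I) (P : pred I) (F : I -> symfun) :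
  (forall i, P i -> Sp g d (F i)) -> Sp g d (\sum_(i <- r | P i) F i).
Proof. by move=> SF; apply: big_ind => //; [apply: Sp0 | apply: Sp_add]. Qed.

Lemma Sp_sum_seq g d (I : eqType) (r : seq I) (F : I -> symfun) :
  {in r, forall i, Sp g d (F i)} -> Sp g d (\sum_(i <- r) F i).
Proof. by move=> SF; rewrite big_seq; apply: Sp_sum. Qed.

Lemma Sp_mul g d d' f f' : Sp g d f -> Sp g d' f' -> Sp g (d + d') (f * f').
Proof.
move=> Sf Sf'; elim: Sf => [|{}f la z _ IH lad]; first by rewrite mul0r; apply: Sp0.
rewrite mulrDl; apply: Sp_add => // {IH}; rewrite mulrzAl; apply: Sp_mulz.
elim: Sf' => [|{}f' mu z' _ IH mud]; first by rewrite mulr0; apply: Sp0.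
rewrite mulrDr; apply: Sp_add => //; rewrite mulrzAr; apply: Sp_mulz.
have ->: gp g la * gp g mu = gp g (mkpart (la ++ mu)).
  by rewrite gp_mkpart /gp ?big_cat // mem_cat negb_or !part_neq0.
by apply: Sp_gp; rewrite sumn_mkpart sumn_cat leq_add.
Qed.

Lemma Sp_le g d d' f : (d <= d')%N -> Sp g d f -> Sp g d' f.
Proof.
move=> dd'; elim=> [|{}f la z _ IH lad]; first exact: Sp0.
by apply: SpS => //; apply: leq_trans dd'.
Qed.

Lemma Sp1 g d : Sp g d 1.
Proof.
have := @Sp_gp g d (mkpart [::]); rewrite gp_mkpart // /gp big_nil; apply.
by rewrite sumn_mkpart.
Qed.

Lemma Sp_gen g k : (0 < k)%N -> Sp g k (g k).
Proof.
move=> k0; have s0: 0%N \notin [:: k] by rewrite inE; case: k k0.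
have := @Sp_gp g k (mkpart [:: k]); rewrite gp_mkpart // /gp big_seq1; apply.
by rewrite sumn_mkpart /= addn0.
Qed.

Lemma Sp_prod g g' s : {in s, forall k, Sp g k (g' k)} -> Sp g (sumn s) (gp g' s).
Proof.
rewrite /gp; elim: s => [|k s IHs] ks; first by rewrite big_nil; apply: Sp1.
rewrite big_cons; apply: Sp_mul; first by apply: ks; rewrite mem_head.
by apply: IHs => i si; apply: ks; rewrite inE si orbT.
Qed.

(** Change of generators: each factor [g' k] is replaced by a combination of products of weight at
    most [k], and weights add under multiplication. *)
Lemma Sp_trans g g' d f : (forall k, (0 < k <= d)%N -> Sp g k (g' k)) ->
  Sp g' d f -> Sp g d f.
Proof.
move=> Sg; elim=> [|{}f la z _ IH lad]; first exact: Sp0.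
apply: Sp_add => //; apply/Sp_mulz/(Sp_le lad)/Sp_prod => k kla.
apply: Sg; rewrite (leq_trans (leq_sumn_mem kla) lad) andbT lt0n.
by apply: contraTneq kla => ->; apply: part_neq0.
Qed.

Lemma Sp_coord g d f : Sp g d f ->
  exists c : intpart -> int, f = \sum_(la <- pseq d) gp g la *~ c la.
Proof.
elim=> [|{}f la z _ [c ->] lad].
  by exists (fun _ => 0); rewrite big1 // => la _; rewrite mulr0z.
exists (fun mu => c mu + (if mu == la then z else 0)).
under [RHS]eq_bigr do rewrite mulrzDr; rewrite big_split /=; congr (_ + _).
rewrite (bigD1_seq la) ?pseq_uniq ?mem_pseq //= eqxx big1 ?addr0 // => mu /negbTE ->.
by rewrite mulr0z.
Qed.

Lemma coord_Sp g d (c : intpart -> int) :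
  Sp g d (\sum_(la <- pseq d) gp g la *~ c la).
Proof.
by apply: Sp_sum_seq => la; rewrite mem_pseq => lad; apply/Sp_mulz/Sp_gp.
Qed.

Lemma deg_le_mul d d' f f' : deg_le d f -> deg_le d' f' -> deg_le (d + d') (f * f').
Proof.
move=> /deg_le_msize fd /deg_le_msize fd'; apply/deg_le_msize => n; rewrite rmorphM /=.
have [->|n0] := eqVneq (sfn n f) 0; first by rewrite mul0r msize0.
have [->|n0'] := eqVneq (sfn n f') 0; first by rewrite mulr0 msize0.
by rewrite msizeM // -subn1 leq_subLR add1n -addSn -addnS leq_add.
Qed.

Lemma deg_le_le d d' f : (d <= d')%N -> deg_le d f -> deg_le d' f.
Proof. by move=> dd' fd la lt; apply: fd; apply: leq_ltn_trans lt. Qed.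

Lemma deg_le1 : deg_le 0 1.
Proof. by apply/deg_le_msize => n; rewrite rmorph1 msize1. Qed.

Lemma deg_le_gp g (s : seq nat) : {in s, forall k, deg_le k (g k)} -> deg_le (sumn s) (gp g s).
Proof.
rewrite /gp; elim: s => [|k s IHs] ks; first by rewrite big_nil; apply: deg_le1.
rewrite big_cons; apply: deg_le_mul; first by apply: ks; rewrite mem_head.
by apply: IHs => i si; apply: ks; rewrite inE si orbT.
Qed.

Lemma deg_le_Sp g d f : (forall k, (0 < k)%N -> deg_le k (g k)) -> Sp g d f -> deg_le d f.
Proof.
move=> gd; elim=> [|{}f la z _ IH lad]; first by move=> la _; rewrite raddf0.
move=> mu dmu; rewrite raddfD /= IH // add0r raddfMz /=.
rewrite (deg_le_le lad (deg_le_gp _)) ?mul0rz // => k kla; apply: gd.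
by rewrite lt0n; apply: contraTneq kla => ->; apply: part_neq0.
Qed.

Lemma deg_le_m (la : intpart) : deg_le (sumn la) (sym_m la).
Proof.
move=> mu lt; rewrite scoef_m; case: eqP => // mula.
by rewrite mula ltnn in lt.
Qed.

Lemma sym_m_expand d f : deg_le d f -> f = \sum_(la <- pseq d) sym_m la *~ scoef la f.
Proof.
move=> fd; apply: scoef_ext => mu; rewrite raddf_sum /=.
under eq_bigr do rewrite raddfMz /= scoef_m.
have [lt|le] := ltnP d (sumn mu).
  rewrite fd // big_seq big1 // => la; rewrite mem_pseq => lad.
  by case: eqP => [E|]; [rewrite E in lt; lia | rewrite mul0rz].
rewrite (bigD1_seq mu) ?pseq_uniq ?mem_pseq //= eqxx intz big1 ?addr0 // => la.
by rewrite eq_sym => /negbTE ->; rewrite mul0rz.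
Qed.

(* Spanning families of the same cardinality as the basis m_la are bases: over *)
(* a commutative ring a one-sided inverse of a square matrix is two-sided.     *)
Lemma gp_free g d (c : intpart -> int) :
    (forall k, (0 < k)%N -> deg_le k (g k)) ->
    (forall f, deg_le d f -> Sp g d f) ->
    \sum_(la <- pseq d) gp g la *~ c la = 0 ->
  forall la : intpart, (sumn la <= d)%N -> c la = 0.
Proof.
move=> gd gS c0; pose N := size (pseq d); pose p (i : 'I_N) := nth (mkpart [::]) (pseq d) i.
have pE (F : intpart -> symfun) : \sum_(la <- pseq d) F la = \sum_i F (p i).
  by rewrite (big_nth (mkpart [::])) big_mkord.
have pd i : (sumn (p i) <= d)%N by rewrite -mem_pseq mem_nth.
have pI : injective p.
  by move=> i j /eqP; rewrite nth_uniq ?pseq_uniq // => /eqP/val_inj.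
have gdeg (la : intpart) : (sumn la <= d)%N -> deg_le d (gp g la).
  by move=> lad; apply: deg_le_Sp gd _; apply: Sp_gp.
have /fin_all_exists [b bE] i : exists c' : intpart -> int,
    sym_m (p i) = \sum_j gp g (p j) *~ c' (p j).
  have [c' ->] := Sp_coord (gS _ (deg_le_le (pd i) (@deg_le_m (p i)))).
  by exists c'; rewrite pE.
pose B := \matrix_(i, j) b i (p j); pose A := \matrix_(i, j) scoef (p j) (gp g (p i)).
have BA : B *m A = 1%:M.
  apply/matrixP => i j; rewrite !mxE.
  have := congr1 (scoef (p j)) (bE i); rewrite scoef_m raddf_sum /= (inj_eq pI) eq_sym => ->.
  by apply: eq_bigr => k _; rewrite raddfMz !mxE /= -mulrzr mulrC intz.
pose C := \row_i c (p i).
have CA : C *m A = 0.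
  apply/rowP => j; rewrite !mxE; have := congr1 (scoef (p j)) c0.
  rewrite pE raddf_sum raddf0 /= => {2}<-; apply: eq_bigr => k _.
  by rewrite raddfMz !mxE /= -mulrzr mulrC intz.
have C0 : C = 0 by rewrite -[C]mulmx1 -(mulmx1C BA) mulmxA CA mul0mx.
move=> la lad; have laP : (index la (pseq d) < N)%N by rewrite index_mem mem_pseq.
have := congr1 (fun M : 'rV_N => M ord0 (Ordinal laP)) C0; rewrite !mxE /p /=.
by rewrite nth_index ?mem_pseq.
Qed.

End Span.

(** * Spanning by elementary and complete functions *)

Section MonomialPartition.

Variable N : nat.

(* The exponent of the variable of index i is the multiplicity of the part i+1. *)
Definition mseq (m : 'X_{1..N}) : seq nat :=
  flatten [seq nseq (m i) i.+1 | i : 'I_N <- enum 'I_N].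

Lemma mseq_pos m : 0%N \notin mseq m.
Proof. by apply/negP => /flatten_mapP[i _]; rewrite mem_nseq andbF. Qed.

Lemma sumn_mseq m : sumn (mseq m) = mnmwgt m.
Proof.
rewrite /mseq sumn_flatten -map_comp sumnE big_map big_enum /=.
by apply: eq_bigr => i _; rewrite /= sumn_nseq mulnC.
Qed.

Lemma gp_mseq g m : gp g (mseq m) = \prod_(i < N) g i.+1 ^+ m i.
Proof.
rewrite /gp /mseq big_flatten big_map big_enum /=; apply: eq_bigr => i _.
by rewrite big_nseq -Monoid.iteropE.
Qed.

Lemma mkpart_mseq_inj : injective (fun m => mkpart (mseq m)).
Proof.
have C (m : 'X_{1..N}) (i : 'I_N) : count_mem i.+1 (mkpart (mseq m)) = m i.
  have /seq.permP -> := perm_mkpart_pos (mseq_pos m).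
  rewrite /mseq count_flatten -map_comp sumnE big_map big_enum (bigD1 i) //=.
  rewrite count_nseq /= eqxx mul1n big1 ?addn0 // => j ji /=.
  by rewrite count_nseq /= eqSS (inj_eq val_inj) (negbTE ji).
by move=> m k mk; apply/mnmP => i; rewrite -!C mk.
Qed.

End MonomialPartition.

Lemma deg_le_e k : deg_le k (elementary k).
Proof.
move=> la lt; rewrite /scoef /sfn /= /elem_seq mcoeff_mesym /mechar mdeg_smon //.
by rewrite gtn_eqF.
Qed.

Lemma mcoeff_h n k (m : 'X_{1..n}) : (sfn n (complete_hom k))@_m = (mdeg m == k)%:R.
Proof.
rewrite /sfn /= /complete_seq (@mcoeff_sumX n k.+1 (fun m => mdeg m == k)) //.
by move=> /eqP ->.
Qed.

Lemma deg_le_h k : deg_le k (complete_hom k).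
Proof. by move=> la lt; rewrite /scoef mcoeff_h mdeg_smon // gtn_eqF. Qed.

(** The fundamental theorem in [d] variables gives a polynomial in e_1, ..., e_d with controlled
    weight; both sides have degree at most [d], so the identity lifts from [d] variables to the
    whole ring. *)
Lemma elementary_span d f : deg_le d f -> Sp elementary d f.
Proof.
move=> fd; have [t [tE tw]] := sym_fundamental (sfn_sym d f).
have SF : Sp elementary d (\sum_(m <- msupp t) gp elementary (mkpart (mseq m)) *~ t@_m).
  apply: Sp_sum_seq => m mt; apply/Sp_mulz/Sp_gp; rewrite sumn_mkpart sumn_mseq.
  rewrite -ltnS; apply: leq_trans (mmeasure_mnm_lt mnmwgt mt) (leq_trans tw _).
  by have /deg_le_msize := fd.
suff -> : f = \sum_(m <- msupp t) gp elementary (mkpart (mseq m)) *~ t@_m by [].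
apply: symfun_eq_deg fd _ _.
  by apply: deg_le_Sp SF => k _; apply: deg_le_e.
rewrite -tE comp_mpolyE rmorph_sum /=; apply: eq_bigr => m _.
rewrite rmorphMz /= gp_mkpart ?mseq_pos // gp_mseq rmorph_prod /= -scaler_int intz.
congr (_ *: _).
by apply: eq_bigr => i _; rewrite rmorphXn /= tnth_mktuple.
Qed.

Lemma mcoeffMX_sub n (p : {mpoly int[n]}) (m k : 'X_{1..n}) :
  (p * 'X_[k])@_m = if (k <= m)%MM then p@_(m - k) else 0.
Proof.
case: ifPn => [km|nkm]; first by rewrite -{1}(submK km) addmC mcoeffMX.
rewrite mcoeffM big1 // => -[k1 k2] /= /eqP mE; rewrite mcoeffX.
case: eqP => [k2k|]; last by rewrite mulr0.
by rewrite mE -k2k lem_addl in nkm.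
Qed.

Lemma mcoeff_eh n i j (m : 'X_{1..n}) :
  (sfn n (elementary i * complete_hom j))@_m =
  \sum_(S : {set 'I_n} | #|S| == i)
     ((mesym1 S <= m)%MM && (mdeg (m - mesym1 S) == j))%:R.
Proof.
rewrite rmorphM /= {1}/sfn /= /elem_seq mesymE mulr_suml raddf_sum /=.
apply: eq_bigr => S _; rewrite mulrC mcoeffMX_sub; case: ifP => // _.
by rewrite mcoeff_h.
Qed.

(* The coefficient of x^m is the alternating sum over the subsets of the *)
(* support of m.                                                          *)
Lemma eh_relation n : (0 < n)%N ->
  \sum_(i < n.+1) (elementary i * complete_hom (n - i)) *~ (-1) ^+ i = 0.
Proof.
move=> n0; apply/sfn_inj => k; apply/mpolyP => m.
rewrite rmorph_sum raddf_sum rmorph0 mcoeff0 /=.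
pose G (S : {set 'I_k}) : int :=
  if (mesym1 S <= m)%MM && (mdeg m == n) then (-1) ^+ #|S| else 0.
transitivity (\sum_(i < n.+1) \sum_(S : {set 'I_k} | #|S| == i) G S).
  apply: eq_bigr => i _; rewrite rmorphMz raddfMz /= mcoeff_eh -mulrzr intz mulr_suml.
  apply: eq_bigr => S /eqP Si; rewrite /G; case: ifP => [/andP[Sm /eqP mn]|].
    have := mdegD (m - mesym1 S) (mesym1 S); rewrite submK // mdeg_mesym1 Sm mn Si => E.
    by rewrite (_ : mdeg (m - mesym1 S) = n - i)%N ?eqxx ?mul1r // (canRL (addnK _) (esym E)).
  case: (boolP (mesym1 S <= m)%MM) => /= [Sm|_ _]; last by rewrite mul0r.
  have := mdegD (m - mesym1 S) (mesym1 S); rewrite submK // mdeg_mesym1 Si => ->.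
  case: (mdeg (m - mesym1 S) =P (n - i)%N) => [->|_ _]; last by rewrite mul0r.
  by rewrite subnK ?eqxx // -ltnS.
(* After the exchange, each [S] is counted once, at i = [#|S|]. If [#|S|] exceeds [n], then [G S] is
   0, as [mesym1 S] cannot lie below a monomial of degree [n]. *)
rewrite (exchange_big_dep xpredT) //=.
transitivity (\sum_(S : {set 'I_k}) G S).
  apply: eq_bigr => S _; have [lt|le] := ltnP #|S| n.+1.
    rewrite (bigD1 (Ordinal lt)) //= big1 ?addr0 // => i /andP[/eqP Si].
    by rewrite -val_eqE /= Si eqxx.
  rewrite /G; case: ifP => [/andP[Sm /eqP mn]|_]; last by rewrite big1.
  have := mdegD (m - mesym1 S) (mesym1 S); rewrite submK // mdeg_mesym1 mn => E.
  by rewrite E ltnNge leq_addl in le.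
have [mn|/negbTE mn] := eqVneq (mdeg m) n; last first.
  by rewrite big1 // => S _; rewrite /G mn andbF.
have [i mi] : exists i, (0 < m i)%N.
  apply/existsP; apply: contraTT n0; rewrite negb_exists => /forallP m0.
  by rewrite -mn mdegE big1 // => i _; have := m0 i; rewrite -eqn0Ngt => /eqP.
(* The sum over [S] factors over the variables, and the factor of a variable that occurs in [m] is
   -1 + 1 = 0. *)
transitivity (\prod_i ((if (0 < m i)%N then -1 else 0) + 1 : int)); last first.
  by rewrite (bigD1 i) //= mi addNr mul0r.
rewrite bigA_distr; apply: eq_bigr => S _; rewrite /G mn eqxx andbT.
case: (boolP (mesym1 S <= m)%MM) => [/mnm_lepP Sm|/mnm_lepP Sm].
  rewrite -prodr_const [LHS]big_mkcond; apply: eq_bigr => j _.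
  by have := Sm j; rewrite mnmE; case: (j \in S) => //= ->.
have /existsP[j] : [exists j, ~~ (mesym1 S j <= m j)%N].
  by rewrite -negb_forall; apply/forallP.
rewrite mnmE -ltnNge; case jS : (j \in S) => //=; rewrite ltnS leqn0 => /eqP mj.
by rewrite (bigD1 j) //= jS mj mul0r.
Qed.

Lemma complete_hom0 : complete_hom 0 = 1.
Proof.
apply/sfn_inj => n; apply/mpolyP => m; rewrite mcoeff_h rmorph1 mcoeff1.
by rewrite mdeg_eq0.
Qed.

Lemma elementary0 : elementary 0 = 1.
Proof. by apply/sfn_inj => n; rewrite rmorph1 /sfn /= /elem_seq mesym0E. Qed.

Lemma elementary_rec n : (0 < n)%N -> elementary n =
  (\sum_(i < n) (elementary i * complete_hom (n - i)) *~ (-1) ^+ i) *~ (-1) ^+ n.+1.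
Proof.
move=> n0; have := eh_relation n0; rewrite big_ord_recr /= subnn complete_hom0 mulr1.
move=> /eqP; rewrite addr_eq0 => /eqP ->.
by rewrite mulNrz -mulrzA exprS mulN1r mulrN -expr2 sqrr_sign mulrN1z opprK.
Qed.

(** By strong induction through [elementary_rec], each e_k is in the span of the products of the h_j
    of weight at most k; then the generators are changed in [elementary_span]. *)
Lemma complete_span d f : deg_le d f -> Sp complete_hom d f.
Proof.
move/elementary_span; apply: Sp_trans => k /andP[+ _].
elim/ltn_ind: k => k IH k0; rewrite elementary_rec //; apply/Sp_mulz/Sp_sum => i _.
apply/Sp_mulz; rewrite -{1}(subnKC (ltnW (ltn_ord i))); apply: Sp_mul.
  have [->|i0] := posnP i; first by rewrite elementary0; apply: Sp1.
  exact: IH.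
by apply: Sp_gen; rewrite subn_gt0.
Qed.

(** * The Hall product and the involution omega *)

Lemma sum_pseq_le (V : zmodType) d d' (c : intpart -> int) (F : intpart -> V) :
  (d <= d')%N -> (forall la : intpart, (d < sumn la)%N -> c la = 0) ->
  \sum_(la <- pseq d') F la *~ c la = \sum_(la <- pseq d) F la *~ c la.
Proof.
move=> dd' c0; rewrite (bigID (fun la : intpart => (sumn la <= d)%N)) /=.
rewrite [X in _ + X]big1 ?addr0 => [|la]; last by rewrite -ltnNge => /c0 ->; rewrite mulr0z.
rewrite -big_filter; apply: perm_big; apply: uniq_perm.
- exact/filter_uniq/pseq_uniq.
- exact: pseq_uniq.
move=> la; rewrite mem_filter !mem_pseq andb_idr // => le; exact: leq_trans le dd'.
Qed.

Lemma sym_h_free d (c : intpart -> int) :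
  \sum_(la <- pseq d) sym_h la *~ c la = 0 ->
  forall la : intpart, (sumn la <= d)%N -> c la = 0.
Proof. by apply: gp_free; [move=> k _; apply: deg_le_h | apply: complete_span]. Qed.

(** The h_la form a Z-basis, so values on them can be prescribed at will. Both the Hall product and
    omega are built from this. *)
Lemma h_lin_ext (V : zmodType) (phi : intpart -> V) :
  exists L : {additive symfun -> V}, forall la, L (sym_h la) = phi la.
Proof.
have ex f : exists x : nat * (intpart -> int),
    (forall la : intpart, (x.1 < sumn la)%N -> x.2 la = 0) /\
    f = \sum_(la <- pseq x.1) sym_h la *~ x.2 la.
  have [d fd] := deg_le_ex f; have [c ->] := Sp_coord (complete_span fd).
  exists (d, fun la : intpart => if (sumn la <= d)%N then c la else 0); split=> /= [la|].
    by rewrite ltnNge => /negbTE ->.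
  rewrite big_seq [RHS]big_seq; apply: eq_bigr => la.
  by rewrite mem_pseq => ->.
have [x xP] := choice ex.
(* Two expansions with different bounds are compared at a common bound [D], also at least [sumn la],
   where freeness applies. The coefficient function is therefore independent of the chosen bound. *)
have uniq f d (c : intpart -> int) : (forall la : intpart, (d < sumn la)%N -> c la = 0) ->
    f = \sum_(la <- pseq d) sym_h la *~ c la -> (x f).2 = c.
  move=> c0 fE; have [x0 fE'] := xP f; apply/funext => la.
  pose D := (maxn (sumn la) (maxn d (x f).1)).
  have /eqP := fE; rewrite {1}fE' -(@sum_pseq_le _ _ D _ _ _ x0); last by rewrite /D; lia.
  rewrite -(@sum_pseq_le _ _ D _ _ _ c0); last by rewrite /D; lia.
  rewrite -subr_eq0 -sumrB; under eq_bigr do rewrite -mulrzBr.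
  move/eqP/sym_h_free => /(_ la); rewrite /D leq_maxl => /(_ isT) /eqP.
  by rewrite subr_eq0 => /eqP.
pose L f := \sum_(la <- pseq (x f).1) phi la *~ (x f).2 la.
have LE f d (c : intpart -> int) : (forall la : intpart, (d < sumn la)%N -> c la = 0) ->
    f = \sum_(la <- pseq d) sym_h la *~ c la -> L f = \sum_(la <- pseq d) phi la *~ c la.
  move=> c0 fE; have [x0 fE'] := xP f; rewrite /L.
  rewrite -(@sum_pseq_le _ _ (maxn d (x f).1) _ _ _ x0) ?leq_maxr //.
  by rewrite (uniq _ _ _ c0 fE); apply: sum_pseq_le; rewrite ?leq_maxl.
have LB : zmod_morphism L.
  move=> f g; pose D := maxn (x f).1 (x g).1.
  have [f0 fE] := xP f; have [g0 gE] := xP g.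
  rewrite (LE (f - g) D (fun la : intpart => (x f).2 la - (x g).2 la)).
  - under eq_bigr do rewrite mulrzBr.
    rewrite sumrB /L -(@sum_pseq_le _ _ D _ _ _ f0) ?leq_maxl //.
    by rewrite -(@sum_pseq_le _ _ D _ _ _ g0) ?leq_maxr.
  - by move=> la; rewrite gtn_max => /andP[/f0 -> /g0 ->]; rewrite subr0.
  - under eq_bigr do rewrite mulrzBr.
    rewrite sumrB (@sum_pseq_le _ _ D _ _ _ f0) ?leq_maxl //.
    by rewrite (@sum_pseq_le _ _ D _ _ _ g0) ?leq_maxr // -fE -gE.
have LA := GRing.isZmodMorphism.Build symfun V L LB.
exists (HB.pack L LA : {additive symfun -> V}) => la /=.
rewrite (LE _ (sumn la) (fun mu : intpart => (mu == la)%:Z)).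
- rewrite (bigD1_seq la) ?pseq_uniq ?mem_pseq //= eqxx big1 ?addr0 // => mu /negbTE ->.
  by rewrite mulr0z.
- by move=> mu; case: eqP => // ->; rewrite ltnn.
- rewrite (bigD1_seq la) ?pseq_uniq ?mem_pseq //= eqxx big1 ?addr0 // => mu /negbTE ->.
  by rewrite mulr0z.
Qed.

Lemma h_ind (P : symfun -> Prop) : P 0 ->
  (forall f la z, P f -> P (f + sym_h la *~ z)) -> forall f, P f.
Proof.
move=> P0 PS f; have [d /complete_span] := deg_le_ex f.
by elim=> // {}f la z _ Pf _; apply: PS.
Qed.

(** Existence: for fixed [g], let [B _ g] be the additive map sending each h_la to the coefficient
    of x^la in [g]. *)
Lemma hallP : is_hall_product hall.
Proof.
apply: (@xgetPex _ _ [set B | is_hall_product B]).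
have [L LE] := choice (fun g => h_lin_ext (fun la : intpart => scoef la g)).
exists (fun f g => L g f); split=> [f1 f2 g|f g1 g2|la mu]; first exact: raddfD.
  elim/h_ind: f => [|f la z IH]; first by rewrite !raddf0 addr0.
  by rewrite !(raddfD, raddfMz) /= IH !LE raddfD /= mulrzDl addrACA.
by rewrite /= LE scoef_m.
Qed.

Fact hall_zmodr f : zmod_morphism (hall f).
Proof.
have [_ hD _] := hallP; have h0 : hall f 0 = 0.
  by apply: (addrI (hall f 0)); rewrite -hD !addr0.
have hN g : hall f (- g) = - hall f g.
  by apply: (addrI (hall f g)); rewrite -hD !subrr.
by move=> g g'; rewrite hD hN.
Qed.

HB.instance Definition _ f :=
  GRing.isZmodMorphism.Build symfun int (hall f) (hall_zmodr f).

(** The flipped pairing can carry the additive structure in the left argument. *)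
Definition rhall g f := hall f g.

Fact rhall_zmod g : zmod_morphism (rhall g).
Proof.
have [hD _ _] := hallP; have h0 : hall 0 g = 0.
  by apply: (addrI (hall 0 g)); rewrite -hD !addr0.
have hN f : hall (- f) g = - hall f g.
  by apply: (addrI (hall f g)); rewrite -hD !subrr.
by move=> f f'; rewrite /rhall hD hN.
Qed.

HB.instance Definition _ g :=
  GRing.isZmodMorphism.Build symfun int (rhall g) (rhall_zmod g).

Lemma hall_h la g : hall (sym_h la) g = scoef la g.
Proof.
have [d gd] := deg_le_ex g; rewrite (sym_m_expand gd) !raddf_sum /=.
apply: eq_bigr => mu _; rewrite !raddfMz /= scoef_m.
by have [_ _ ->] := hallP.
Qed.

Lemma hall0l g : hall 0 g = 0.
Proof. exact: (raddf0 (rhall g)). Qed.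

Lemma hallDl x y g : hall (x + y) g = hall x g + hall y g.
Proof. exact: (raddfD (rhall g)). Qed.

Lemma hallMzl x z g : hall (x *~ z) g = hall x g *~ z.
Proof. exact: (raddfMz (rhall g)). Qed.

Lemma hall_suml (I : Type) (r : seq I) (P : pred I) (F : I -> symfun) g :
  hall (\sum_(i <- r | P i) F i) g = \sum_(i <- r | P i) hall (F i) g.
Proof. exact: (raddf_sum (rhall g)). Qed.

(** * Coefficients of products as numbers of matrices with given margins *)

Section MatrixCount.

(** The sum of the monomials of degree [k] with exponents at most [c]: it is e_k for c = 1 and h_k
    for c >= k, so that one count serves both families. *)
Definition bpoly c n k : {mpoly int[n]} :=
  \sum_(f : {ffun 'I_n -> 'I_c.+1} | (\sum_i f i)%N == k) 'X_[[multinom val (f i) | i < n]].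

Lemma mcoeff_bpoly c n k (m : 'X_{1..n}) :
  (bpoly c n k)@_m = ((mdeg m == k) && [forall i, m i <= c]%N)%:R.
Proof.
rewrite /bpoly raddf_sum /=; under eq_bigr do rewrite mcoeffX.
case: (boolP [forall i, m i <= c]%N) => [/forallP mc|/forallP mc]; last first.
  rewrite andbF big1 // => f _; case: eqP => // fm; case: mc => i.
  by rewrite -fm mnmE -ltnS.
rewrite andbT; pose f0 : {ffun 'I_n -> 'I_c.+1} := [ffun i => inord (m i)].
have f0E i : val (f0 i) = m i by rewrite ffunE /= inordK ?ltnS.
have f0s : (\sum_i f0 i)%N = mdeg m by rewrite mdegE; apply: eq_bigr => i _; apply: f0E.
have f0m (f : {ffun 'I_n -> 'I_c.+1}) :
    ([multinom val (f i) | i < n] == m) = (f == f0).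
  apply/eqP/eqP => [fm|->]; last by apply/mnmP => i; rewrite mnmE f0E.
  by apply/ffunP => i; apply/val_inj; rewrite f0E -fm mnmE.
under eq_bigr do rewrite f0m.
case: (mdeg m =P k) => [mk|mk].
  rewrite (bigD1 f0) /= ?f0s ?mk // eqxx big1 ?addr0 // => f /andP[_ /negbTE ->] //.
rewrite big1 // => f /eqP fk; case: eqP => // ff0.
by case: mk; rewrite -f0s -ff0.
Qed.

Lemma sfn_e n k : sfn n (elementary k) = bpoly 1 n k.
Proof.
apply/mpolyP => m; rewrite mcoeff_bpoly.
by rewrite /sfn /= /elem_seq mcoeff_mesym /mechar.
Qed.

Lemma sfn_h c n k : (k <= c)%N -> sfn n (complete_hom k) = bpoly c n k.
Proof.
move=> kc; apply/mpolyP => m; rewrite mcoeff_bpoly mcoeff_h.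
case: (mdeg m =P k) => //= mk; suff -> : [forall i, m i <= c]%N by [].
apply/forallP => i; apply: leq_trans kc; rewrite -mk mdegE.
by rewrite (bigD1 i) //= leq_addr.
Qed.

Definition mats c r n (b a : nat -> nat) :=
  [set F : {ffun 'I_r -> {ffun 'I_n -> 'I_c.+1}} |
    [forall j : 'I_r, (\sum_i F j i)%N == b j] &&
    [forall i : 'I_n, (\sum_j F j i)%N == a i]].

(** Expanding the product selects a row of sum [b j] from each factor; the exponents of the
    resulting monomial are the column sums. *)
Lemma mcoeff_prod_bpoly c r n (b a : nat -> nat) :
  (\prod_(j < r) bpoly c n (b j))@_[multinom a i | i < n] = #|mats c r n b a|%:R.
Proof.
rewrite bigA_distr_big_dep raddf_sum /= -sum1_card natr_sum big_mkcond [RHS]big_mkcond.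
apply: eq_bigr => F _.
rewrite mprodXE mcoeffX inE.
rewrite [X in (if X then _ else _) = _](_ : _ = [forall j : 'I_r, (\sum_i F j i)%N == b j]) //.
rewrite [F \in mats _ _ _ _ _]inE; case: ifP => //= _.
set L := (_ == _); suff -> : L = [forall i : 'I_n, (\sum_j F j i)%N == a i] by case: ifP.
apply/eqP/forallP => [/mnmP Fa i|Fa].
  have := Fa i; rewrite mnm_sumE mnmE => <-; apply/eqP.
  by apply: eq_bigr => j _; rewrite mnmE.
apply/mnmP => i; rewrite mnm_sumE mnmE -(eqP (Fa i)).
by apply: eq_bigr => j _; rewrite mnmE.
Qed.

(** Transposition is injective; applied in both directions, the inequality yields equality. *)
Lemma leq_card_mats c r n b a : (#|mats c r n b a| <= #|mats c n r a b|)%N.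
Proof.
pose T (F : {ffun 'I_r -> {ffun 'I_n -> 'I_c.+1}}) := 
  [ffun i : 'I_n => [ffun j : 'I_r => F j i]] : {ffun 'I_n -> {ffun 'I_r -> 'I_c.+1}}.
have Tinj : injective T.
  move=> F G /ffunP FG; apply/ffunP => j; apply/ffunP => i.
  by have := congr1 (fun f : {ffun _ -> _} => f j) (FG i); rewrite !ffunE.
rewrite -(card_imset _ Tinj); apply: subset_leq_card.
apply/fintype.subsetP => _ /imsetP[F + ->].
rewrite !inE => /andP[/forallP Fb /forallP Fa]; apply/andP; split; apply/forallP => i.
  by rewrite -(eqP (Fa i)); apply/eqP; apply: eq_bigr => j _; rewrite !ffunE.
by rewrite -(eqP (Fb i)); apply/eqP; apply: eq_bigr => j _; rewrite !ffunE.
Qed.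

Lemma scoef_gp c g (la mu : intpart) :
  (forall n k, k \in parts mu -> sfn n (g k) = bpoly c n k) ->
  scoef la (gp g mu) = #|mats c (size mu) (size la) (nth 0%N mu) (nth 0%N la)|%:R.
Proof.
move=> gE; rewrite -mcoeff_prod_bpoly /scoef /smon; congr mcoeff.
rewrite /gp (big_nth 0%N) big_mkord rmorph_prod; apply: eq_bigr => i _ /=.
by rewrite gE // mem_nth.
Qed.

Lemma scoef_h_sym (la mu : intpart) : scoef la (sym_h mu) = scoef mu (sym_h la).
Proof.
(* This entry bound dominates every part of both partitions, so every factor h_k that occurs equals
   [bpoly] at the bound. *)
rewrite !(@scoef_gp (sumn la + sumn mu)).
- by congr _%:R; apply/eqP; rewrite eqn_leq !leq_card_mats.
- by move=> n k kla; apply: sfn_h; have := leq_sumn_mem kla; lia.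
- by move=> n k kla; apply: sfn_h; have := leq_sumn_mem kla; lia.
Qed.

Lemma scoef_e_sym (la mu : intpart) : scoef la (sym_e mu) = scoef mu (sym_e la).
Proof.
rewrite !(@scoef_gp 1); try by move=> n k _; apply: sfn_e.
by congr _%:R; apply/eqP; rewrite eqn_leq !leq_card_mats.
Qed.

End MatrixCount.

Lemma hall_sym f g : hall f g = hall g f.
Proof.
elim/h_ind: f g => [|f la z IH] g; first by rewrite raddf0 hall0l.
rewrite hallDl hallMzl !(raddfD, raddfMz) /= IH; congr (_ + _ *~ _).
elim/h_ind: g => [|g mu y IHg]; first by rewrite raddf0 hall0l.
rewrite hallDl hallMzl !(raddfD, raddfMz) /= IHg; congr (_ + _ *~ _).
by rewrite !hall_h scoef_h_sym.
Qed.

(** This is [eh_relation] with the index reversed, which multiplies the signs by (-1)^n. *)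
Lemma he_relation n : (0 < n)%N ->
  \sum_(i < n.+1) (complete_hom i * elementary (n - i)) *~ (-1) ^+ i = 0.
Proof.
move=> n0; have := congr1 (fun f => f *~ (-1) ^+ n) (eh_relation n0); rewrite mul0rz => E.
rewrite -[RHS]E {E} mulrz_suml [RHS](reindex_inj rev_ord_inj) /=; apply: eq_bigr => i _.
have le_in : (i <= n)%N by rewrite -ltnS.
rewrite subSS subKn // mulrC -mulrzA; congr (_ *~ _).
by rewrite -[X in _ = _ * (-1) ^+ X](subnK le_in) exprD mulrA -expr2 sqrr_sign mul1r.
Qed.

(* omega is self-adjoint because <h_a, e_b> counts the 0-1 matrices with        *)
(* margins a and b, hence is symmetric in a and b.                             *)
Lemma omega_ex : exists om : {additive symfun -> symfun},
  [/\ forall la : intpart, om (sym_h la) = sym_e la,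
      forall la : intpart, om (sym_e la) = sym_h la,
      forall f g, om (f * g) = om f * om g
    & forall f g, hall (om f) g = hall f (om g)].
Proof.
have [om omE] := h_lin_ext sym_e; exists om.
have catE (g : nat -> symfun) (la mu : intpart) : gp g la * gp g mu = gp g (mkpart (la ++ mu)).
  by rewrite gp_mkpart /gp ?big_cat // mem_cat negb_or !part_neq0.
have omM f g : om (f * g) = om f * om g.
  elim/h_ind: f => [|f la z IH]; first by rewrite !(mul0r, raddf0).
  rewrite mulrDl !raddfD mulrDl -IH mulrzAl !raddfMz mulrzAl; congr (_ + _ *~ _).
  elim/h_ind: g {IH} => [|g mu y IHg]; first by rewrite !(mulr0, raddf0).
  rewrite mulrDr !raddfD mulrDr -IHg mulrzAr !raddfMz mulrzAr; congr (_ + _ *~ _).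
  by rewrite [LHS](congr1 om (catE complete_hom la mu)) !omE; rewrite [RHS]catE.
have om1 : om 1 = 1.
  have := omE (mkpart [::]); rewrite /sym_h /sym_e.
  by rewrite -/(gp complete_hom _) -/(gp elementary _) !gp_mkpart // /gp !big_nil.
have omh k : om (complete_hom k) = elementary k.
  have [->|k0] := posnP k; first by rewrite complete_hom0 elementary0.
  have s0: 0%N \notin [:: k] by rewrite inE; case: k k0.
  have := omE (mkpart [:: k]); rewrite /sym_h /sym_e.
  by rewrite -/(gp complete_hom _) -/(gp elementary _) !gp_mkpart // /gp !big_seq1.
(* Applying [om] to the e-h relation and comparing with the h-e relation, induction identifies all
   terms but the last, which give the claim for [k]. *)
have ome k : om (elementary k) = complete_hom k.
  elim/ltn_ind: k => k IH; have [->|k0] := posnP k; first by rewrite complete_hom0 elementary0.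
  have := congr1 om (eh_relation k0).
  rewrite raddf0 -[X in _ = X -> _](he_relation k0) raddf_sum /=.
  rewrite !big_ord_recr /= !raddfMz !omM !subnn omh elementary0 !mulr1.
  set X := \sum_(i < k) _; set Y := \sum_(i < k) _.
  have -> : X = Y.
    by apply: eq_bigr => i _; rewrite raddfMz omM omh IH.
  move/addrI/(congr1 (fun f => f *~ (-1) ^+ k)).
  by rewrite -!mulrzA -expr2 sqrr_sign !mulr1z.
have omeE (la : intpart) : om (sym_e la) = sym_h la.
  rewrite /sym_e /sym_h; elim: (parts la) => [|k s IHs]; first by rewrite !big_nil.
  by rewrite !big_cons omM IHs ome.
split=> // f g; elim/h_ind: f => [|f la z IH].
  by rewrite raddf0 !hall0l.
rewrite !(raddfD, raddfMz) /= !(hallDl, hallMzl) IH omE.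
congr (_ + _ *~ _); elim/h_ind: g {IH} => [|g mu y IHg]; first by rewrite !raddf0.
rewrite !(raddfD, raddfMz) /= IHg omE; congr (_ + _ *~ _).
by rewrite hall_sym !hall_h scoef_e_sym.
Qed.

(** * Coefficients of h_mu p_n *)

Lemma mpart_U k (i : 'I_k) n : (0 < n)%N -> mpart (U_(i) *+ n)%MM = mkpart [:: n].
Proof.
case: k i => [[]//|k] i n0; transitivity (mpart (smon k.+1 [:: n])); last first.
  by rewrite -(mkpart1 n0) mkpart_id mpart_smon // mkpart1.
apply/val_inj; rewrite -[RHS]/(mshape (smon k.+1 [:: n])) -[LHS]/(mshape (U_(i) *+ n)).
rewrite -(mshape_perm (smon k.+1 [:: n]) (tperm ord0 i)).
congr mshape; apply/mnmP => j; rewrite mulmnE mnm1E !mnmE.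
case: tpermP => [->|->|j0 ji]; last 1 first.
- have [ij|_] := eqVneq i j; first by case: ji.
  by case: j j0 {ji} => [[|j] jk] // j0; [case: j0; apply/val_inj | rewrite mul0n /= nth_nil].
- have [->|i0] := eqVneq i ord0; first by rewrite mul1n.
  by case: i i0 => [[|i] ik] // _; rewrite mul0n /= nth_nil.
- by rewrite eqxx mul1n.
Qed.

(** This identifies m_(n) with the power sum: an exponent vector of shape (n) is a permutation of n
    followed by zeros. *)
Lemma sfn_p k n : (0 < n)%N ->
  sfn k (sym_m (mkpart [:: n])) = \sum_(i < k) 'X_[U_(i) *+ n].
Proof.
move=> n0; apply/mpolyP => m; rewrite mcoeff_scoef scoef_m raddf_sum /=.
under eq_bigr do rewrite mcoeffX.
have [mE|mN] := eqVneq (mpart m) (mkpart [:: n]); last first.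
  rewrite big1 // => i _; case: eqP => // mi.
  by rewrite -mi mpart_U ?eqxx in mN.
have [i mi] : exists i : 'I_k, m = (U_(i) *+ n)%MM.
  case: k m mE => [|k] m mE.
    have := mdeg_mshape m; rewrite -[mshape m]/(parts (mpart m)) mE sumn_mkpart /= addn0.
    by rewrite mdegE big_ord0 => n1; rewrite -n1 in n0.
  have : mshape (U_(ord0 : 'I_k.+1) *+ n)%MM = mshape m.
    by have := congr1 parts mE; rewrite -(congr1 parts (mpart_U (@ord0 k) n0)) => /esym.
  move/mshape_eq_perm; rewrite perm_sym => /tuple_permP[s ms]; exists ((s^-1)%g ord0).
  apply/mnmP => j; rewrite mulmnE mnm1E (mnm_nth 0%N) ms.
  rewrite (nth_map j) ?size_enum_ord // nth_ord_enum -mnm_tnth mulmnE mnm1E.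
  by congr (nat_of_bool _ * n)%N; rewrite -(inj_eq (@perm_inj _ s) ((s^-1)%g ord0) j) permKV.
rewrite (bigD1 i) //= -mi eqxx big1 ?addr0 // => j /negbTE ji.
case: eqP => // /mnmP/(_ i); rewrite mi !mulmnE !mnm1E eqxx ji mul0n mul1n => E.
by rewrite -E in n0.
Qed.

(** Multiplication by the n-th power of a variable shifts one exponent, so only the indices with
    la_i >= n contribute. *)
Lemma scoef_mul_p (la : intpart) f n k : (0 < n)%N -> (size la <= k)%N ->
  scoef la (f * sym_m (mkpart [:: n])) =
  \sum_(i < k) (if (n <= nth 0%N la i)%N then (sfn k f)@_(smon k la - U_(i) *+ n) else 0).
Proof.
move=> n0 kla; rewrite -(mcoeff_smon _ kla) rmorphM /= sfn_p // mulr_sumr raddf_sum /=.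
apply: eq_bigr => i _; rewrite mcoeffMX_sub.
suff -> : (U_(i) *+ n <= smon k la)%MM = (n <= nth 0%N la i)%N by [].
apply/mnm_lepP/idP => [/(_ i)|le j]; rewrite mulmnE mnm1E mnmE ?eqxx ?mul1n //.
by case: eqP => [<-|_]; rewrite ?mul1n ?mul0n.
Qed.

Lemma mcoeff_hM n k q (m : 'X_{1..n}) :
  (sfn n (complete_hom k) * q)@_m =
  \sum_(m' : 'X_{1..n < k.+1} | mdeg m' == k)
     (if (m' <= m)%MM then q@_(m - m') else 0).
Proof.
rewrite /sfn /= /complete_seq mulr_suml raddf_sum /=; apply: eq_bigr => m' _.
by rewrite mulrC mcoeffMX_sub.
Qed.

Lemma sub_mnm n (m : 'X_{1..n}) k : (k <= mdeg m)%N ->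
  exists m' : 'X_{1..n}, (m' <= m)%MM /\ mdeg m' = k.
Proof.
elim: k => [|k IHk] km.
  by exists 0%MM; rewrite mdeg0; split=> //; apply/mnm_lepP => i; rewrite mnm0E.
have [m' [m'm m'k]] := IHk (ltnW km).
have [i mi] : exists i, (m' i < m i)%N.
  apply/existsP; apply: contraTT km; rewrite negb_exists => /forallP mm.
  rewrite -leqNgt -m'k !mdegE; apply: leq_sum => i _.
  by have := mm i; rewrite -leqNgt.
exists (m' + U_(i))%MM; rewrite mdegD mdeg1 m'k addn1; split=> //.
apply/mnm_lepP => j; rewrite mnmDE mnm1E; case: eqP => [<-|_]; first by rewrite addn1.
by rewrite addn0; apply: (mnm_lepP m'm).
Qed.

Lemma mdegB_le n (m m' : 'X_{1..n}) : (m' <= m)%MM -> mdeg (m - m') = (mdeg m - mdeg m')%N.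
Proof. by move=> /submK {2}<-; rewrite mdegD addnK. Qed.

Lemma h_coef_ge0 n (s : seq nat) (m : 'X_{1..n}) : 0 <= (sfn n (gp complete_hom s))@_m.
Proof.
rewrite /gp; elim: s m => [|k s IHs] m; first by rewrite big_nil rmorph1 mcoeff1 ler0n.
rewrite big_cons rmorphM /= mcoeff_hM; apply: sumr_ge0 => m' _.
by case: ifP.
Qed.

(** One choice of monomial of degree [k] below [m] for the first factor leaves a remainder of the
    right degree; all other contributions are nonnegative. *)
Lemma h_coef_ge1 n (s : seq nat) (m : 'X_{1..n}) : mdeg m = sumn s ->
  1 <= (sfn n (gp complete_hom s))@_m.
Proof.
rewrite /gp; elim: s m => [|k s IHs] m /=.
  by move=> /eqP; rewrite mdeg_eq0 big_nil rmorph1 mcoeff1 => ->.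
move=> ms; rewrite big_cons rmorphM /= mcoeff_hM.
have [|m' [m'm m'k]] := @sub_mnm _ m k; first by rewrite ms leq_addr.
have m'P : (mdeg m' < k.+1)%N by rewrite m'k.
rewrite (bigD1 (BMultinom m'P)) /= ?m'k //= m'm -[1]addr0; apply: lerD.
  by apply: IHs; rewrite mdegB_le // ms m'k addKn.
by apply: sumr_ge0 => m2 _; case: ifP => // _; apply: h_coef_ge0.
Qed.

(** The first factor may contribute [c + U_(i)] or [c + U_(j)], where [c] has degree k - 1 and lies
    below m - U_i - U_j. Such a [c] exists because [m] has degree at least k + 1. Each choice adds
    at least 1. *)
Lemma h_coef_ge2 n k (s : seq nat) (m : 'X_{1..n}) (i j : 'I_n) :
  (0 < k)%N -> (0 < sumn s)%N -> mdeg m = (k + sumn s)%N ->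
  i != j -> (0 < m i)%N -> (0 < m j)%N ->
  2 <= (sfn n (gp complete_hom (k :: s)))@_m.
Proof.
move=> k0 s0 ms ij mi mj.
have ijm : (U_(i) + U_(j) <= m)%MM.
  apply/mnm_lepP => l; rewrite mnmDE !mnm1E.
  have [<-|_] := eqVneq i l; first by rewrite eq_sym (negbTE ij).
  by have [<-|_] := eqVneq j l.
have [|c [cm ck]] := @sub_mnm _ (m - (U_(i) + U_(j)))%MM k.-1.
  by rewrite mdegB_le // mdegD !mdeg1 ms; lia.
have cle l : l \in [:: i; j] -> (c + U_(l) <= m)%MM.
  move=> lij; apply/mnm_lepP => x; have := mnm_lepP cm x; have := mnm_lepP ijm x.
  rewrite mnmBE !mnmDE !mnm1E; move: lij; rewrite !inE => /orP[]/eqP ->; lia.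
have cdeg l : mdeg (c + U_(l)) = k by rewrite mdegD mdeg1 ck addn1 prednK.
have cP l : (mdeg (c + U_(l)) < k.+1)%N by rewrite cdeg.
rewrite /gp big_cons rmorphM /= mcoeff_hM.
rewrite (bigD1 (BMultinom (cP i))) /= ?cdeg //= cle ?mem_head //.
rewrite (bigD1 (BMultinom (cP j))) /=; last first.
  rewrite cdeg eqxx -val_eqE /=; apply: contra_neqN ij => /eqP/addmI/mnmP/(_ i).
  by rewrite !mnm1E eqxx; case: eqP => [->|].
rewrite cle ?inE ?eqxx ?orbT // addrA -[2]addr0; apply: lerD.
  apply: (@lerD _ 1 _ 1); apply: h_coef_ge1;
    by rewrite mdegB_le ?cle ?inE ?eqxx ?orbT // ms cdeg addKn.
by apply: sumr_ge0 => m2 _; case: ifP => // _; apply: h_coef_ge0.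
Qed.

Lemma nth_part_le (la : intpart) i j : (i <= j)%N -> (nth 0%N la j <= nth 0%N la i)%N.
Proof.
move=> ij; have [lt|le] := ltnP j (size la); last by rewrite nth_default.
case: la lt => s /= /andP[ss _] lt.
have geq_trans : transitive geq by move=> x y z /= yx /leq_trans; apply.
have geq_refl : reflexive geq by move=> x; apply: leqnn.
by apply: (sorted_leq_nth geq_trans geq_refl 0%N ss); rewrite ?inE // (leq_ltn_trans ij).
Qed.

Lemma nth_part_gt0 (la : intpart) i : (i < size la)%N -> (0 < nth 0%N la i)%N.
Proof.
move=> lt; rewrite lt0n; apply: contraNneq (part_neq0 la) => <-.
exact: mem_nth.
Qed.

(** By [scoef_h_sym] this is the coefficient of x^mu in h_t. The case t = 0 is separate, as
    [mpart_U] requires a positive exponent. *)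
Lemma h_coef_U n (mu : intpart) (i : 'I_n) t : t = sumn mu ->
  (sfn n (gp complete_hom mu))@_(U_(i) *+ t) = 1.
Proof.
move=> tE; have [t0|t0] := posnP t.
  have -> : parts mu = [::].
    by apply/size0nil/eqP; rewrite -leqn0 -t0 tE size_le_sumn.
  by rewrite t0 mulm0n /gp big_nil rmorph1.
rewrite mcoeff_scoef mpart_U // -[gp _ _]/(sym_h mu) scoef_h_sym /sym_h.
have s0: 0%N \notin [:: t] by rewrite inE; case: t t0 {tE}.
rewrite -/(gp complete_hom _) gp_mkpart // /gp big_seq1 /scoef mcoeff_h mdeg_smon //.
by rewrite tE eqxx.
Qed.

Lemma h_coef_size1 n (mu : intpart) (m : 'X_{1..n}) : (size mu <= 1)%N ->
  mdeg m = sumn mu -> (sfn n (gp complete_hom mu))@_m = 1.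
Proof.
rewrite /gp; case: (parts mu) => [|k [|//]] _ /=.
  by move/eqP; rewrite mdeg_eq0 big_nil rmorph1 mcoeff1 => ->.
by rewrite addn0 big_seq1 mcoeff_h => ->; rewrite eqxx.
Qed.

Section PowerSumCoefficient.

Variables (la mu : intpart) (n : nat).
Hypotheses (n0 : (0 < n)%N) (lamu : sumn la = (sumn mu + n)%N).

Let k := (size la).+2.
Let i0 : 'I_k := ord0.
Let i1 : 'I_k := lift ord0 ord0.
Let c (i : 'I_k) := (sfn k (gp complete_hom mu))@_(smon k la - U_(i) *+ n).
Let S := scoef la (sym_h mu * sym_m (mkpart [:: n])).

Let SE : S = \sum_(i < k) (if (n <= nth 0%N la i)%N then c i else 0).
Proof. by rewrite /S (scoef_mul_p _ n0 (k := k)) // /k; lia. Qed.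

Let mdeg_k : mdeg (smon k la) = sumn la.
Proof. by rewrite mdeg_smon // /k; lia. Qed.

Let Ule (i : 'I_k) : (n <= nth 0%N la i)%N -> (U_(i) *+ n <= smon k la)%MM.
Proof.
move=> le; apply/mnm_lepP => j; rewrite mulmnE mnm1E mnmE.
by case: eqP => [<-|_]; rewrite ?mul1n ?mul0n.
Qed.

Let mdegU (i : 'I_k) : (n <= nth 0%N la i)%N -> mdeg (smon k la - U_(i) *+ n) = sumn mu.
Proof. by move=> le; rewrite mdegB_le ?Ule // mdegMn mdeg1 mul1n mdeg_k lamu addnK. Qed.

Lemma scoef_hp_ge0 : 0 <= S.
Proof.
by rewrite SE; apply: sumr_ge0 => i _; case: ifP => // _; apply: h_coef_ge0.
Qed.

Let S0 : (nth 0%N la 0 < n)%N -> S = 0.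
Proof.
move=> lt; rewrite SE big1 // => i _; rewrite leqNgt.
by rewrite (leq_ltn_trans (nth_part_le la (leq0n i)) lt).
Qed.

(** The indices 0 and 1 both contribute, each at least 1. *)
Let S2 : (n <= nth 0%N la 1)%N -> 2 <= S.
Proof.
move=> le1; have le0 := leq_trans le1 (nth_part_le la (leq0n 1)).
rewrite SE (bigD1 i0) //= le0 (bigD1 i1) //= le1 addrA -[2]addr0; apply: lerD.
  by apply: (@lerD _ 1 _ 1); apply: h_coef_ge1; apply: mdegU.
by apply: sumr_ge0 => i _; case: ifP => // _; apply: h_coef_ge0.
Qed.

Let S1 : (nth 0%N la 1 < n <= nth 0%N la 0)%N -> S = c i0.
Proof.
case/andP=> lt1 le0; rewrite SE (bigD1 i0) //= le0 big1 ?addr0 // => i ii0.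
rewrite leqNgt (leq_ltn_trans (nth_part_le la _) lt1) //.
by rewrite lt0n; apply: contra ii0 => /eqP i0E; apply/eqP/val_inj.
Qed.

(** Once index 0 alone contributes, the value is 1 exactly when [mu] has at most one part or la - n
    eps_0 has at most one nonzero entry. The latter means that la_2 = 0 (case 3), or that la_1 = n
    and la has at most two parts (case 2), with parts numbered from 1. *)
Lemma scoef_hp_eq1 : S = 1 <->
  let m := (sumn la - n)%N in
  (n <= nth 0%N la 0)%N /\
     [\/ (mu = nonzero_parts [:: m] :> seq nat) /\ (nth 0%N la 1 < n)%N,
         [/\ la = nonzero_parts [:: n; m] :> seq nat, (m < n)%N
            & sumn mu = m]
       | (la = [:: (n + m)%N] :> seq nat) /\ sumn mu = m].
Proof.
have mE : (sumn la - n = sumn mu)%N by rewrite lamu addnK.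
have n_neq0 : n != 0%N by rewrite -lt0n.
cbv zeta; rewrite mE; split=> [SE1|[le0 cond]].
  have le0 : (n <= nth 0%N la 0)%N.
    by rewrite leqNgt; apply/negP => /S0; rewrite SE1.
  have lt1 : (nth 0%N la 1 < n)%N.
    by rewrite ltnNge; apply/negP => /S2; rewrite SE1.
  split=> //; have [mu1|mu2] := leqP (size mu) 1.
    apply: Or31; split=> //; have := part_neq0 mu.
    case: (parts mu) mu1 => [|a [|//]] //= _; rewrite inE addn0 eq_sym => a0.
    by rewrite /nonzero_parts /= a0.
  have cE : c i0 = 1 by rewrite -SE1 S1 // lt1.
  (* Here [mu] has at least two parts, so two nonzero entries of la - n eps_0 would make the
     coefficient at least 2. *)
  have no2 (i j : 'I_k) : i != j -> (0 < (smon k la - U_(i0) *+ n)%MM i)%N ->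
      (0 < (smon k la - U_(i0) *+ n)%MM j)%N -> False.
    move=> ij mi mj; have := mdegU (i := i0) le0; move: cE (@nth_part_gt0 mu); rewrite /c.
    case: (parts mu) mu2 => [//|a [//|b s]] _ cE pos md.
    have := @h_coef_ge2 k a (b :: s) _ i j (pos 0%N isT) _ md ij mi mj.
    rewrite cE => /(_ _) H; have := pos 1%N isT => /= b0; suff: (2 : int) <= 1 by [].
    by apply: H; rewrite /= addn_gt0 b0.
  have mval i : (smon k la - U_(i0) *+ n)%MM i = (nth 0%N la i - (i0 == i) * n)%N.
    by rewrite mnmBE mulmnE mnm1E mnmE.
  have sz0 : (0 < size la)%N.
    by rewrite ltnNge; apply: contraTN le0 => ?; rewrite nth_default // -ltnNge.
  have [la1|la1] := posnP (nth 0%N la 1).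
    apply: Or33; split=> //; have : (size la <= 1)%N.
      by rewrite leqNgt; apply: contra_eqN la1 => /nth_part_gt0; rewrite lt0n.
    move: sz0 lamu; case: (parts la) => [|a [|//]] //= _.
    by rewrite addn0 => ->; rewrite addnC.
  have la0 : nth 0%N la 0 = n.
    apply/eqP; rewrite eqn_leq le0 andbT leqNgt; apply/negP => gt0.
    by apply: (no2 i0 i1); rewrite ?mval //= ?mul0n ?subn0 // mul1n subn_gt0.
  have sz2 : (1 < size la)%N.
    by rewrite ltnNge; apply: contraTN la1 => ?; rewrite nth_default.
  have la2 : (size la <= 2)%N.
    rewrite leqNgt; apply/negP => sz3; have := nth_part_gt0 sz3 => la2.
    have ik : (2 < k)%N by rewrite /k; lia.
    by apply: (no2 i1 (Ordinal ik)); rewrite ?mval //= mul0n subn0.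
  have smu : sumn mu = nth 0%N la 1.
    move: la0 sz2 la2 lamu; case: (parts la) => [|a [|b [|//]]] //= -> _ _.
    by rewrite addn0 addnC => /addIn.
  apply: Or32; split; rewrite ?smu //.
  move: la0 sz2 la2 la1; case: (parts la) => [|a [|b [|//]]] //= -> _ _ b0.
  by rewrite /nonzero_parts /= n_neq0 -lt0n b0.
(* For the converse, la - n eps_0 is concentrated at [i1] in the second case and at [i0] in the
   third. *)
have Usub t (i : 'I_k) : (forall j : 'I_k, nth 0%N la j - (i0 == j) * n = (i == j) * t)%N ->
    (smon k la - U_(i0) *+ n)%MM = (U_(i) *+ t)%MM.
  by move=> H; apply/mnmP => j; rewrite mnmBE !mulmnE !mnm1E mnmE.
case: cond => [[muE lt1]|[laE mn _]|[laE _]].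
- rewrite S1 ?lt1 //; apply: h_coef_size1; last exact: mdegU.
  by rewrite muE /nonzero_parts /=; case: ifP.
- have lt1 : (nth 0%N la 1 < n)%N.
    by rewrite laE /nonzero_parts /= n_neq0; case: ifP.
  rewrite S1 ?lt1 // /c (Usub (sumn mu) i1); first by apply: h_coef_U.
  move=> j; rewrite laE /nonzero_parts /= n_neq0; case: j => [[|[|j]] jk] /=.
  + by rewrite mul1n subnn.
  + by case: eqP => [->|_] /=; rewrite ?mul0n ?mul1n ?subn0.
  + by case: ifP => _ /=; rewrite ?nth_nil.
- have lt1 : (nth 0%N la 1 < n)%N by rewrite laE.
  rewrite S1 ?lt1 // /c (Usub (sumn mu) i0); first by apply: h_coef_U.
  move=> j; rewrite laE; case: j => [[|j] jk] /=; first by rewrite !mul1n addKn.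
  by rewrite nth_nil.
Qed.

End PowerSumCoefficient.

(** * Skew elementary functions and the criterion *)

(** Zero is homogeneous of every degree. *)
Definition hom_deg d (f : symfun) :=
  forall la : intpart, sumn la != d -> scoef la f = 0.

Lemma homog_mcoeff d f n (m : 'X_{1..n}) : hom_deg d f -> mdeg m != d -> (sfn n f)@_m = 0.
Proof. by move=> fd md; rewrite mcoeff_scoef fd // -mdeg_mshape. Qed.

Lemma homog_mul d d' f g : hom_deg d f -> hom_deg d' g -> hom_deg (d + d') (f * g).
Proof.
move=> fd gd la lad; rewrite /scoef rmorphM mcoeffM /= big1 // => -[k1 k2] /= /eqP mE.
have [k1d|k1d] := eqVneq (mdeg k1) d; last by rewrite (homog_mcoeff fd) ?mul0r.
rewrite [X in _ * X](homog_mcoeff gd) ?mulr0 //; apply: contra_neq lad => k2d.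
by rewrite -(mdeg_smon (leqnn (size la))) mE mdegD k1d k2d.
Qed.

Lemma homog1 : hom_deg 0 1.
Proof.
by move=> la la0; rewrite /scoef rmorph1 mcoeff1 -mdeg_eq0 mdeg_smon // (negbTE la0).
Qed.

Lemma homog_gp g (s : seq nat) : (forall k, hom_deg k (g k)) -> hom_deg (sumn s) (gp g s).
Proof.
move=> gh; rewrite /gp; elim: s => [|k s IHs]; first by rewrite big_nil; apply: homog1.
by rewrite big_cons; apply: homog_mul.
Qed.

Lemma homog_elementary k : hom_deg k (elementary k).
Proof.
move=> la lak; rewrite /scoef /sfn /= /elem_seq mcoeff_mesym /mechar mdeg_smon //.
by rewrite (negbTE lak).
Qed.

Lemma homog_complete k : hom_deg k (complete_hom k).
Proof. by move=> la lak; rewrite /scoef mcoeff_h mdeg_smon // (negbTE lak). Qed.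

Lemma homog_m (la : intpart) : hom_deg (sumn la) (sym_m la).
Proof.
move=> mu lamu; rewrite scoef_m; case: eqP => // mula.
by rewrite mula eqxx in lamu.
Qed.

(** A homogeneous [f] of degree [d] is a combination of the h_la with |la| = d, and pairing with
    these reads coefficients of [g] in degree [d], which vanish. *)
Lemma hall_homog d d' f g : hom_deg d f -> hom_deg d' g -> d != d' -> hall f g = 0.
Proof.
move=> fd gd dd'; have [D fD] := deg_le_ex f; have [c fE] := Sp_coord (complete_span fD).
suff -> : f = \sum_(la <- pseq D | sumn la == d) sym_h la *~ c la.
  rewrite hall_suml big1 // => la /eqP lad.
  by rewrite hallMzl hall_h gd ?mul0rz // lad.
apply: scoef_ext => nu; rewrite [RHS]raddf_sum /=; have [nud|nud] := eqVneq (sumn nu) d.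
  rewrite fE raddf_sum /= (bigID (fun la : intpart => sumn la == d)) /=.
  rewrite [X in _ + X]big1 ?addr0 // => la lad; rewrite raddfMz /=.
  by rewrite (homog_gp homog_complete) ?mul0rz // nud eq_sym.
rewrite fd // big1 // => la /eqP lad; rewrite raddfMz /=.
by rewrite (homog_gp homog_complete) ?mul0rz // lad.
Qed.

(** By duality with the m_nu, the coordinate at h_nu is the pairing with m_nu. *)
Lemma h_expand d f : Sp complete_hom d f ->
  f = \sum_(nu <- pseq d) sym_h nu *~ hall f (sym_m nu).
Proof.
move=> /Sp_coord[c fE]; rewrite {1}fE big_seq [RHS]big_seq; apply: eq_bigr => nu nud.
congr (_ *~ _); rewrite fE hall_suml (bigD1_seq nu) ?pseq_uniq //=.
rewrite !hallMzl hall_h scoef_m eqxx intz big1 ?addr0 // => la lanu.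
by rewrite hallMzl hall_h scoef_m (negbTE lanu) mul0rz.
Qed.

Section SkewElementary.

Variables (la mu : intpart) (n : nat).
Hypothesis lamu : is_skew_part n la mu.

Lemma skew_hall_homog d g : hom_deg d g -> d != n ->
  hall (sym_e la) (sym_e mu * g) = 0.
Proof.
move=> gd dn; apply: hall_homog (homog_gp homog_elementary) _ _.
  exact: homog_mul (homog_gp homog_elementary) gd.
by rewrite lamu eqn_add2l eq_sym.
Qed.

(** The point is existence: the witness has as h_nu-coordinates the required pairings with m_nu.
    Those with |nu| > n vanish by degree, so a finite sum suffices. *)
Lemma hall_skew_e f : hall (skew_e la mu) f = hall (sym_e la) (sym_e mu * f).
Proof.
move: f; apply: (@xgetPex _ 0 [set u | forall f, hall u f = hall (sym_e la) (sym_e mu * f)]).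
pose u := \sum_(nu <- pseq n) sym_h nu *~ hall (sym_e la) (sym_e mu * sym_m nu).
have um nu : hall u (sym_m nu) = hall (sym_e la) (sym_e mu * sym_m nu).
  have uh : Sp complete_hom n u by apply: coord_Sp.
  rewrite hall_suml.
  have [le|lt] := leqP (sumn nu) n.
    rewrite (bigD1_seq nu) ?pseq_uniq ?mem_pseq //= hallMzl hall_h scoef_m eqxx intz.
    by rewrite big1 ?addr0 // => ka kanu; rewrite hallMzl hall_h scoef_m (negbTE kanu) mul0rz.
  rewrite (skew_hall_homog (@homog_m nu)) ?gtn_eqF //.
  rewrite big_seq big1 // => ka; rewrite mem_pseq => kan; rewrite hallMzl hall_h scoef_m.
  by case: eqP kan => [->|]; rewrite ?mul0rz // leqNgt lt.
exists u => f /=; have [d fd] := deg_le_ex f.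
rewrite (sym_m_expand fd) mulr_sumr !raddf_sum /=.
by apply: eq_bigr => nu _; rewrite mulrzAr !raddfMz /= um.
Qed.

Lemma skew_e_span : Sp complete_hom n (skew_e la mu).
Proof.
have [d ud] := deg_le_ex (skew_e la mu); rewrite (h_expand (complete_span ud)).
apply: Sp_sum => nu _; have [nun|nun] := eqVneq (sumn nu) n.
  by apply/Sp_mulz/Sp_gp; rewrite nun.
rewrite hall_skew_e (skew_hall_homog (@homog_m nu)) //.
by rewrite mulr0z; apply: Sp0.
Qed.

End SkewElementary.

(** * Pairing with power sums *)

Definition pn n := sym_m (mkpart [:: n]).

Lemma homog_pn n : hom_deg n (pn n).
Proof. by have := @homog_m (mkpart [:: n]); rewrite sumn_mkpart /= addn0. Qed.

Lemma scoef0_homog d f : hom_deg d f -> (0 < d)%N -> scoef [::] f = 0.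
Proof.
by move=> fd d0; have := fd (mkpart [::]); apply; rewrite sumn_mkpart /= neq_ltn d0.
Qed.

Lemma scoef01 : scoef [::] 1 = 1.
Proof. by rewrite /scoef rmorph1 mcoeff1 (_ : _ == _) //; apply/eqP/mnmP => -[]. Qed.

Lemma hall1p n : (0 < n)%N -> hall 1 (pn n) = 0.
Proof.
by move=> n0; apply: hall_homog homog1 (@homog_pn n) _; rewrite neq_ltn n0.
Qed.

Lemma sumn_part_gt0 (la : intpart) : parts la != [::] -> (0 < sumn la)%N.
Proof. by rewrite -size_eq0 -lt0n => /leq_trans; apply; apply: size_le_sumn. Qed.

(** [scoef [::]] is the constant term, so this is the derivation rule. By bilinearity it reduces to
    h_la and h_mu; if neither index is empty, their product is indexed by a partition with at least
    two parts, hence orthogonal to m_(n). *)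
Lemma hall_p_mul n f g : (0 < n)%N ->
  hall (f * g) (pn n) = scoef [::] f * hall g (pn n) + hall f (pn n) * scoef [::] g.
Proof.
move=> n0; have h0 (la : intpart) : parts la != [::] -> scoef [::] (sym_h la) = 0.
  by move=> /sumn_part_gt0; apply: scoef0_homog; apply: homog_gp homog_complete.
elim/h_ind: f => [|f la z IH]; first by rewrite !(mul0r, hall0l, raddf0) add0r.
rewrite mulrDl mulrzAl !(hallDl, hallMzl) IH !(raddfD, raddfMz) /= !mulrDl addrACA.
congr (_ + _).
rewrite !mulrzAl -mulrzDl; congr (_ *~ _) => {f IH}.
elim/h_ind: g => [|g mu y IH]; first by rewrite !(mulr0, hall0l, raddf0) add0r.
rewrite mulrDr mulrzAr !(hallDl, hallMzl) IH !(raddfD, raddfMz) /= !mulrDr addrACA.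
congr (_ + _).
rewrite !mulrzAr -mulrzDl; congr (_ *~ _) => {g IH}.
have [la0|la0] := eqVneq (parts la) [::].
  have -> : sym_h la = 1 by rewrite /sym_h la0 big_nil.
  by rewrite mul1r scoef01 mul1r hall1p // mul0r addr0.
have [mu0|mu0] := eqVneq (parts mu) [::].
  have -> : sym_h mu = 1 by rewrite /sym_h mu0 big_nil.
  by rewrite mulr1 scoef01 mulr1 hall1p // mulr0 add0r.
rewrite !h0 // mul0r mulr0 addr0.
have -> : sym_h la * sym_h mu = sym_h (mkpart (la ++ mu)).
  rewrite -[RHS]/(gp complete_hom (mkpart _)) gp_mkpart /gp ?big_cat //.
  by rewrite mem_cat negb_or !part_neq0.
rewrite hall_h scoef_m; case: eqP => // /(congr1 (fun nu : intpart => size nu)).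
rewrite mkpart1 // (perm_size (perm_mkpart_pos _)); last by rewrite mem_cat negb_or !part_neq0.
rewrite size_cat; case: (parts la) la0 => // a s _.
by case: (parts mu) mu0 => //= b t; rewrite addnS.
Qed.

Lemma hall_h_p n : (0 < n)%N -> hall (complete_hom n) (pn n) = 1.
Proof.
move=> n0; have := hall_h (mkpart [:: n]) (pn n).
by rewrite scoef_m eqxx /sym_h mkpart1 // big_seq1.
Qed.

(** In the e-h relation the terms with 0 < i < n are decomposable and pair to 0, which leaves h_n
    and (-1)^n e_n. *)
Lemma hall_e_p n : (0 < n)%N -> hall (elementary n) (pn n) = (-1) ^+ n.+1.
Proof.
move=> n0; have := congr1 (hall^~ (pn n)) (eh_relation n0).
rewrite hall0l hall_suml big_ord_recr subnn /= complete_hom0 mulr1 hallMzl mulrzz.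
rewrite (bigD1 (Ordinal n0)) //= big1 ?addr0 => [|i i0]; last first.
  have {}i0 : (0 < i)%N by rewrite lt0n; apply: contra i0 => /eqP iE; apply/eqP/val_inj.
  rewrite hallMzl hall_p_mul // (scoef0_homog (@homog_elementary i)) //.
  by rewrite (scoef0_homog (@homog_complete (n - i)%N)) ?subn_gt0 // mul0r mulr0 addr0 mul0rz.
rewrite subn0 elementary0 mul1r mulr1z hall_h_p // => /eqP.
rewrite addr_eq0 => /eqP/(congr1 (fun x => x * (-1) ^+ n)).
by rewrite mul1r mulNr -mulrA -expr2 sqrr_sign mulr1 exprS mulN1r => ->; rewrite opprK.
Qed.

Lemma hall_skew_p (la mu : intpart) n : (0 < n)%N -> is_skew_part n la mu ->
  hall (skew_e la mu) (pn n) = scoef la (sym_h mu * pn n) * (-1) ^+ n.+1.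
Proof.
move=> n0 lamu; rewrite (hall_skew_e lamu).
have [om [omh ome omM adj]] := omega_ex.
(* Pairing omega(p_n) with h_nu gives <e_nu, p_n> by adjointness, and this is 0 unless nu = (n). *)
have omp : om (pn n) = pn n *~ (-1) ^+ n.+1.
  apply: scoef_ext => nu; rewrite raddfMz /= -!hall_h -adj omh hall_h scoef_m.
  have [->|nun] := eqVneq nu (mkpart [:: n]).
    by rewrite /sym_e mkpart1 // big_seq1 hall_e_p // intz.
  rewrite mul0rz /sym_e; have := part_neq0 nu; case nuE: (parts nu) => [|k s].
    by rewrite big_nil hall1p.
  rewrite inE negb_or eq_sym -lt0n => /andP[k0 s0]; rewrite big_cons hall_p_mul //.
  rewrite (scoef0_homog (@homog_elementary k)) // mul0r add0r.
  have [sE|sN] := eqVneq s [::].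
    rewrite sE big_nil scoef01 mulr1; have [kn|kn] := eqVneq k n.
      case/eqP: nun; apply/val_inj; rewrite /= nuE sE kn.
      by rewrite -[RHS]/(parts (mkpart [:: n])) mkpart1.
    exact: hall_homog (@homog_elementary k) (@homog_pn n) kn.
  rewrite -/(gp elementary s) (scoef0_homog (homog_gp homog_elementary)) ?mulr0 //.
  case: s sN s0 {nuE} => // a s _; rewrite inE negb_or eq_sym -lt0n => /andP[a0 _] /=.
  by rewrite addn_gt0 a0.
by rewrite -omh adj omM ome omp mulrzAr raddfMz /= hall_h mulrzz.
Qed.

(** The units of Z are 1 and -1; the coefficient is nonnegative, so -1 is excluded. *)
Lemma skew_e_p_unit (la mu : intpart) n : (0 < n)%N -> is_skew_part n la mu ->
  hall (skew_e la mu) (pn n) \is a GRing.unit <-> scoef la (sym_h mu * pn n) = 1.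
Proof.
move=> n0 lamu; rewrite hall_skew_p // unitrM unitrX ?unitrN1 // andbT.
have := scoef_hp_ge0 n0 lamu; rewrite -/(pn n); set S := scoef _ _ => S0.
split=> [SU|-> //].
have /orP[/eqP //|/eqP SN] : (S == 1) || (S == -1) := SU.
by rewrite SN in S0.
Qed.

Lemma generates_hall_p_unit (u : nat -> symfun) n : (0 < n)%N ->
  (forall k, k != n -> hall (u k) (pn n) = 0) -> alg_generates u ->
  hall (u n) (pn n) \is a GRing.unit.
Proof.
(* [Q] says that [c] divides the pairing with p_n. It holds for 1 and each [u k] and passes to
   products and integer combinations, hence to h_n, whose pairing is 1. *)
move=> n0 u0 gen; pose c := hall (u n) (pn n); pose Q f := (c %| hall f (pn n))%Z.
have QM f g : Q f -> Q g -> Q (f * g).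
  by rewrite /Q hall_p_mul // => Qf Qg; apply: rpredD; [apply: dvdz_mull | apply: dvdz_mulr].
have Q1 : Q 1 by rewrite /Q hall1p // dvdz0.
have [N [P PE]] := gen (complete_hom n).
suff : Q (complete_hom n).
  rewrite /Q hall_h_p // => /dvdzP[x xc]; apply/unitrP; exists x.
  by rewrite -/c [c * x]mulrC -xc.
rewrite -PE /zeval /mmap {1}/Q hall_suml; apply: rpred_sum => m _.
rewrite mulrzl hallMzl -mulrzr; apply: dvdz_mulr; apply: (big_ind Q) => // i _.
elim: (m i) => [|k IHk] //; rewrite exprS; apply: QM => //; rewrite /Q.
by have [->|kn] := eqVneq (val i) n; [apply: dvdzz | rewrite u0 // dvdz0].
Qed.

(** Triangular inversion: u_k = c h_k + R with c = 1 or -1, and R involves only h_j with j < k,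
    which are expressed in [u] by induction. *)
Lemma complete_Sp_of_unit (u : nat -> symfun) :
  (forall k, (0 < k)%N -> Sp complete_hom k (u k)) ->
  (forall n, (0 < n)%N -> hall (u n) (pn n) \is a GRing.unit) ->
  forall k, (0 < k)%N -> Sp u k (complete_hom k).
Proof.
move=> uS uU k; elim/ltn_ind: k => k IH k0.
have := h_expand (uS _ k0); set c := hall (u k); pose nk := mkpart [:: k].
have nkk : nk \in pseq k by rewrite mem_pseq sumn_mkpart /= addn0.
rewrite (bigD1_seq nk) ?pseq_uniq //= -/(pn k); set R := \sum_(_ <- _ | _) _ => uE.
have SR : Sp u k R.
  rewrite /R big_seq_cond; apply: Sp_sum => nu /andP[]; rewrite mem_pseq => nuk nunk.
  apply/Sp_mulz/(Sp_le nuk)/Sp_prod => j jnu; apply: IH; last first.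
    by rewrite lt0n; apply: contraTneq jnu => ->; apply: part_neq0.
  (* A part equal to [k] would exhaust the weight and force nu = (k), which is excluded from [R]. *)
  rewrite ltn_neqAle (leq_trans (leq_sumn_mem jnu) nuk) andbT.
  apply: contraNneq nunk => jk; apply/eqP/part_perm_eq; rewrite mkpart1 //.
  rewrite {}jk in jnu; have pe := perm_to_rem jnu; rewrite (permPl pe).
  suff -> : rem k nu = [::] by [].
  have r0 : sumn (rem k nu) = 0%N by have := perm_sumn pe; rewrite /=; lia.
  have : 0%N \notin rem k nu by apply: contra (part_neq0 nu); apply: mem_rem.
  by case: (rem k nu) r0 => // -[|b] t.
have hE : sym_h nk = complete_hom k by rewrite /sym_h mkpart1 // big_seq1.
have cU : c (pn k) * c (pn k) = 1.
  have /orP[/eqP|/eqP] : (c (pn k) == 1) || (c (pn k) == -1) := uU _ k0.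
    by move=> ->.
  by move=> ->.
have -> : complete_hom k = (u k - R) *~ c (pn k).
  by rewrite {1}uE addrK hE -mulrzA cU mulr1z.
by apply/Sp_mulz/Sp_add; [apply: Sp_gen | apply: Sp_opp].
Qed.

(** * From spanning to generation and independence *)

Lemma span_generates (u : nat -> symfun) :
  (forall d f, deg_le d f -> Sp u d f) -> alg_generates u.
Proof.
move=> uS f; have [d /uS uf] := deg_le_ex f.
(* Indices of weight at most [d] lie between 0 and [d], hence d + 1 variables. *)
exists d.+1; elim: uf => [|{}f la z _ [P PE] lad]; first by exists 0; rewrite /zeval raddf0.
exists (P + (\prod_(k <- la) 'X_(inord k)) *~ z).
rewrite /zeval raddfD raddfMz /= -/(zeval u P) PE rmorph_prod /=; congr (_ + _ *~ _).
rewrite /gp big_seq [RHS]big_seq; apply: eq_bigr => k kla; rewrite mmapX mmap1U inordK //.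
by rewrite ltnS (leq_trans (leq_sumn_mem kla)).
Qed.

(** Variable [i] stands for u_(i+1), as in [mseq], so distinct monomials give distinct partitions
    and a polynomial relation becomes a linear one between products, to which [gp_free] applies. *)
Lemma span_alg_independent (u : nat -> symfun) :
  (forall k, (0 < k)%N -> deg_le k (u k)) ->
  (forall d f, deg_le d f -> Sp u d f) -> alg_independent (fun i => u i.+1).
Proof.
move=> ud uS N P P0; apply/mpolyP => m; rewrite mcoeff0.
pose c (la : intpart) := \sum_(k <- msupp P | mkpart (mseq k) == la) P@_k.
(* A crude bound: the sum of the weights of all monomials of [P] dominates each of them. *)
pose d := (\sum_(k <- msupp P) mnmwgt k)%N.
have kd k : k \in msupp P -> (sumn (mkpart (mseq k)) <= d)%N.
  by move=> kP; rewrite sumn_mkpart sumn_mseq /d (bigD1_seq k) //= leq_addr.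
have cm k : c (mkpart (mseq k)) = P@_k.
  rewrite /c; under eq_bigl do rewrite (inj_eq (@mkpart_mseq_inj N)).
  have [kP|kP] := boolP (k \in msupp P).
    by rewrite -big_filter filter_pred1_uniq ?big_seq1.
  rewrite (memN_msupp_eq0 kP) big_seq_cond big1 // => j /andP[jP /eqP jk].
  by rewrite -jk jP in kP.
have [mP|/memN_msupp_eq0 //] := boolP (m \in msupp P).
rewrite -cm; apply: (gp_free ud (uS d)); last exact: kd.
rewrite -[RHS]P0 /zeval /mmap.
transitivity (\sum_(la <- pseq d) \sum_(k <- msupp P | mkpart (mseq k) == la) gp u la *~ P@_k).
  by apply: eq_bigr => la _; rewrite -mulrz_sumr.
rewrite (exchange_big_dep xpredT) //= big_seq [RHS]big_seq; apply: eq_bigr => k kP.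
rewrite (eq_bigl (pred1 (mkpart (mseq k)))) => [|la]; last by rewrite /= eq_sym.
rewrite -big_filter filter_pred1_uniq ?pseq_uniq ?mem_pseq ?kd // big_seq1.
by rewrite gp_mkpart ?mseq_pos // gp_mseq -mulrzl.
Qed.

Theorem theorem3p11 (la mu : nat -> intpart)
    (Hskew : forall n : nat, is_skew_part n (la n) (mu n)) :
  let u := fun n : nat => skew_e (la n) (mu n) in
  (alg_independent (fun i : nat => u i.+1) /\ alg_generates u)
  <->
  (forall n : nat, (1 <= n)%N ->
     let m := (sumn (la n) - n)%N in
     (n <= nth 0%N (la n) 0)%N /\
     [\/ (mu n = nonzero_parts [:: m] :> seq nat) /\ (nth 0%N (la n) 1 < n)%N,
         [/\ la n = nonzero_parts [:: n; m] :> seq nat, (m < n)%N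
            & sumn (mu n) = m]
       | (la n = [:: (n + m)%N] :> seq nat) /\ sumn (mu n) = m]).
Proof.
move=> u.
(* For each n >= 1, the combinatorial condition is equivalent to <u_n, p_n> being 1 or -1. *)
have crit n : (0 < n)%N -> hall (u n) (pn n) \is a GRing.unit <-> _ :=
  fun n0 => iff_trans (skew_e_p_unit n0 (Hskew n)) (scoef_hp_eq1 n0 (Hskew n)).
split=> [[_ gen] n n0|cond].
  apply/crit => //; apply: generates_hall_p_unit => // k kn.
  rewrite /u (hall_skew_e (Hskew k)).
  by apply: (skew_hall_homog (Hskew k) (@homog_pn n)); rewrite eq_sym.
have uS k : (0 < k)%N -> Sp complete_hom k (u k) by move=> _; apply: skew_e_span.
have ud k : (0 < k)%N -> deg_le k (u k).
  by move/uS; apply: deg_le_Sp => j _; apply: deg_le_h.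
have uspan d f : deg_le d f -> Sp u d f.
  move=> /complete_span; apply: Sp_trans => k /andP[k0 _].
  by apply: complete_Sp_of_unit k0 => // n n0; apply/(crit n n0)/cond.
by split; [apply: span_alg_independent | apply: span_generates].
Qed.
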